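(* There exists a universal constant $C>0$ such that the following holds. Let $d\ge 3$, let $p^*$ be a halfspace-symmetric probability distribution on $\mathbb{R}^d$ with center $\mu^*$ and decay function $h(t)=\sup_{v\in\mathbb{R}^d,\ \|v\|_*\le 1} p^*(v^\top(X-\mu^* )>t)$, $t\ge 0$. Let $n\ge 1$, $\delta\in(0,1)$, $\epsilon\in[0,1)$, and let $\hat p_n$ be the corrupted empirical distribution of $n$ samples under either the oblivious or the adaptive total variation corruption model of level $\epsilon$. Set $$\tilde\epsilon=\epsilon+C\sqrt{\frac{d+1+\log(1/\delta)}{n}}.$$ If $2\tilde\epsilon<1-h(0)$, then with probability at least $1-\delta$, every Tukey median $\hat\mu\in T(\hat p_n)$ satisfies $$\|\hat\mu-\mu^*\|\le h^{-1}\left(1-h(0)-2\tilde\epsilon\right),$$ where $h^{-1}(y)=\inf\{x : h(x)<y\}$ is the generalized inverse of $h$.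
   Context: $\|\cdot\|$ is a norm on $\mathbb{R}^d$ and $\|\cdot\|_*$ is its dual norm. The function $h$ is defined on $[0,\infty)$ and the infimum in $h^{-1}(y)$ is over $x\ge 0$. Tukey depth and median: for a probability distribution $p$ on $\mathbb{R}^d$ and $\mu\in\mathbb{R}^d$, $D_{\mathsf{Tukey}}(\mu,p)=\inf_{v\in\mathbb{R}^d} p(v^\top (X-\mu)\ge 0)$ and $T(p)=\operatorname{argmax}_{\mu\in\mathbb{R}^d} D_{\mathsf{Tukey}}(\mu,p)$, the set of all maximizers. Halfspace-symmetric: $p$ is halfspace-symmetric with center $\mu\in\mathbb{R}^d$ if, for $X\sim p$ and every $v\in\mathbb{R}^d$, $v^\top(X-\mu)$ and $-v^\top(X-\mu)$ are equal in distribution. Total variation distance: $\mathsf{TV}(p,q)=\sup_A\, (p(A)-q(A))$ over events $A$. Oblivious corruption of level $\epsilon$: the adversary first picks a distribution $p$ with $\mathsf{TV}(p,p^* )\le\epsilon$; then $n$ i.i.d. samples are drawn from $p$, and $\hat p_n$ is their empirical distribution. Adaptive corruption of level $\epsilon$: first $n$ i.i.d. samples are drawn from $p^*$; then the adversary samples a number $n'$ from some distribution that is stochastically dominated by the binomial distribution $\mathsf{B}(n,\epsilon)$ and replaces $n'$ of the sample points by arbitrary points; $\hat p_n$ is the empirical distribution of the resulting $n$ points. *)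

(* Defs.v *)
From HB Require Import structures.
From mathcomp Require Import all_boot all_order all_algebra.
From mathcomp Require Import all_classical all_reals all_analysis.

Set Implicit Arguments.
Unset Strict Implicit.
Unset Printing Implicit Defensive.

Import Order.TTheory GRing.Theory Num.Theory.
Import numFieldNormedType.Exports.

Local Open Scope classical_set_scope.
Local Open Scope ring_scope.

(* R^d is 'cV[R]_d with its Borel sigma-algebra, generated by the open sets of
   the library's topology on matrices. *)
HB.instance Definition _ (R : realType) (d : nat) :=
  @isMeasurable.Build (sigma_display (@open 'cV[R]_d)) 'cV[R]_d
    <<s @open 'cV[R]_d >> (@sigma_algebra0 _ setT _)
    (@sigma_algebraC _ _) (@sigma_algebra_bigcup _ setT _).

Definition dotp (R : realType) (d : nat) (v x : 'cV[R]_d) : R :=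
  (v^T *m x) 0 0.

(* The library already puts the sup norm on 'cV[R]_d, so an arbitrary norm is a
   function with the norm axioms; nonnegativity follows from them. *)
Definition is_norm (R : realType) (d : nat) (N : 'cV[R]_d -> R) : Prop :=
  [/\ forall x y, N (x + y) <= N x + N y,
      forall (a : R) x, N (a *: x) = `|a| * N x
    & forall x, N x = 0 -> x = 0].

Definition dual_norm (R : realType) (d : nat) (N : 'cV[R]_d -> R)
    (v : 'cV[R]_d) : R :=
  sup [set dotp v x | x in [set x | N x <= 1]].

Section tukey.
Context (R : realType) (d : nat).
Implicit Types (p : {measure set 'cV[R]_d -> \bar R}) (mu : 'cV[R]_d).

Definition tukey_depth mu p : \bar R :=
  ereal_inf [set p [set x | 0 <= dotp v (x - mu)] | v in [set: 'cV[R]_d]].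

Definition tukey_median p : set 'cV[R]_d :=
  [set mu | forall nu, (tukey_depth nu p <= tukey_depth mu p)%E].

End tukey.

Section distributions.
Context (R : realType) (d : nat).
Implicit Types (p q : probability 'cV[R]_d R) (mu : 'cV[R]_d).

Definition halfspace_symmetric p mu : Prop :=
  forall (v : 'cV[R]_d) (B : set R), measurable B ->
    pushforward p (fun x => dotp v (x - mu)) B =
    pushforward p (fun x => - dotp v (x - mu)) B.

Definition total_variation p q : \bar R :=
  ereal_sup [set (p A - q A)%E | A in [set A | measurable A]].

Definition decay (N : 'cV[R]_d -> R) p mu (t : R) : R :=
  sup [set fine (p [set x | t < dotp v (x - mu)]) |
       v in [set v | dual_norm N v <= 1]].

End distributions.

(* Extended-real valued, so that the infimum of the empty set is +oo. *)
Definition generalized_inverse (R : realType) (h : R -> R) (y : R) : \bar R :=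
  ereal_inf [set x%:E | x in [set x | 0 <= x /\ h x < y]].

Section empirical.
Context (R : realType) (d n : nat).
Local Open Scope ereal_scope.

Definition empirical (x : 'I_n -> 'cV[R]_d) (A : set 'cV[R]_d) : \bar R :=
  (n%:R^-1)%R%:E * \sum_(i < n) \d_(x i) A.

Variable x : 'I_n -> 'cV[R]_d.

Let y (k : nat) : 'cV[R]_d := if insub k is Some i then x i else 0%R.

Let empiricalE : empirical x =
  mscale ((n%:R^-1)%:nng)%R (msum (fun k => \d_(y k)) n).
Proof.
apply/funext => A; rewrite /empirical /mscale /msum /=; congr (_ * _).
by apply: eq_bigr => i _; rewrite /y valK.
Qed.

Let empirical0 : empirical x set0 = 0.
Proof. by rewrite empiricalE measure0. Qed.

Let empirical_ge0 A : 0 <= empirical x A.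
Proof. by rewrite empiricalE measure_ge0. Qed.

Let empirical_sigma_additive : semi_sigma_additive (empirical x).
Proof. by rewrite empiricalE; exact: measure_semi_sigma_additive. Qed.

HB.instance Definition _ := isMeasure.Build _ _ _ (empirical x)
  empirical0 empirical_ge0 empirical_sigma_additive.

Lemma empirical_setT : (0 < n)%N -> empirical x [set: _] = 1.
Proof.
move=> n0; rewrite /empirical; under eq_bigr do rewrite diracT.
rewrite sumEFin -EFinM sumr_const card_ord -[(1 *+ n)%R]/(n%:R)%R.
by rewrite mulVf// pnatr_eq0 -lt0n.
Qed.

End empirical.

Section sampling.
Context (R : realType) (d n : nat) (disp : measure_display)
  (Omega : measurableType disp) (P : probability Omega R).
Implicit Types (p : probability 'cV[R]_d R) (X Y : 'I_n -> Omega -> 'cV[R]_d).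

Definition mutually_independent X : Prop :=
  forall (J : {set 'I_n}) (A : 'I_n -> set 'cV[R]_d),
    (forall i, measurable (A i)) ->
    P (\bigcap_(i in [set i | i \in J]) (X i @^-1` A i)) =
    (\prod_(i in J) P (X i @^-1` A i))%E.

Definition iid p X : Prop :=
  [/\ forall i, measurable_fun setT (X i),
      forall i (A : set 'cV[R]_d), measurable A -> pushforward P (X i) A = p A
    & mutually_independent X].

Definition oblivious_corruption (pstar : probability 'cV[R]_d R) (eps : R)
    Y : Prop :=
  exists p, (total_variation p pstar <= eps%:E)%E /\ iid p Y.

Definition binomially_dominated (K : Omega -> nat) (eps : R) : Prop :=
  forall k : nat, (P [set w | (k <= K w)%N] <=
    binomial_prob n eps [set j | (k <= j)%N])%E.

(* K is the number of replaced points and S their positions. Only the law of K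
   is constrained: K, S and the new points may depend on the clean sample X
   (and on any further randomness in Omega), and the new points are arbitrary,
   not even assumed to depend measurably on w. *)
Definition adaptive_corruption (pstar : probability 'cV[R]_d R) (eps : R)
    Y : Prop :=
  exists (X : 'I_n -> Omega -> 'cV[R]_d) (K : Omega -> nat),
    [/\ iid pstar X, measurable_fun setT K, binomially_dominated K eps
      & forall w, exists S : {set 'I_n},
          #|S| = K w /\ forall i, i \notin S -> Y i w = X i w].

(* "A holds with probability at least r" for an A that need not be
   measurable: A contains an event of probability at least r. *)
Definition with_probability_ge (r : R) (A : set Omega) : Prop :=
  exists E : set Omega, [/\ measurable E, E `<=` A & (r%:E <= P E)%E].

End sampling.

(* Main.v *)
Require Import Defs.
From mathcomp Require Import all_boot all_order all_algebra.
From mathcomp Require Import all_classical all_reals all_analysis.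
From mathcomp Require Import ring lra.

Set Implicit Arguments.
Unset Strict Implicit.
Unset Printing Implicit Defensive.

Import Order.TTheory GRing.Theory Num.Theory.
Import numFieldNormedType.Exports.

Local Open Scope ring_scope.

(** The theorem separates into a deterministic part and a uniform deviation
    bound.

    Suppose that the empirical mass of every closed halfspace is within [eta]
    of its mass under [p]. The center [mu] has depth at least [1 - h 0] under
    [p], hence at least [1 - h 0 - eta] empirically; so does the empirical
    median, by maximality, and the median has depth at least
    [1 - h 0 - 2 * eta] under [p]. A point at distance more than [t] from [mu]
    has depth at most [h t]: cut at that point with a functional norming its
    difference with [mu] ([hahn_banach]). Hence [h t < 1 - h 0 - 2 * eta]
    excludes a distance larger than [t] ([tukey_median_close]).

    It remains to take [eta = eps + C * sqrt ((d + 1 + ln (1 / delta)) / n)],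
    without a factor [ln n]. Oblivious corruption changes each mass by at most
    [eps]. In the adaptive model the number of replaced points has a binomial
    tail ([binomial_tail]), and replacing [k] points moves each empirical mass
    by at most [k / n]. So the sample may be assumed uncorrupted.

    For finitely many halfspaces only the cells that they cut out matter, and
    the sample is a point of a finite product space; the deviation bound is a
    statement about finite sums ([uniform_deviation]). Comparison with an
    independent second sample ([ghost_sample]) and random exchanges of the two
    samples ([pr_swap]) reduce it to the maximum over [f] in a family [F] of
    subsets of the [n] indices of a sum of independent signs over [f]. The family
    has Vapnik-Chervonenkis dimension at most [d + 1] ([VC_halfspaces]). The
    lemma of Sauer and Shelah, applied to random subsamples of the indices, shows
    that [F] has nets of size [(4 / e) ^ O(d)] at every scale [e], whatever
    [n] is ([packing]), and chaining along the scales [4 ^ (- j)] gives the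
    maximal inequality ([rademacher_maximal]).

    The bound does not depend on the number of halfspaces, so it passes to the
    countably many open halfspaces with rational data by continuity of
    measures, and from these to all closed halfspaces by pointwise limits
    ([closed_halfspace_deviation]). *)

(** * Probability on finite product spaces *)

Section finite_probability.
Variable R : realType.

Definition weight (X : finType) (w : X -> R) :=
  (forall x, 0 <= w x) /\ \sum_x w x = 1.

Definition pr (X : finType) (w : X -> R) (A : pred X) := \sum_(x | A x) w x.

(** The weight of a sample of [n] independent points of law [q]. *)
Definition prodw (T : finType) (q : T -> R) n (x : {ffun 'I_n -> T}) :=
  \prod_i q (x i).

Section pr.
Variables (X : finType) (w : X -> R).
Hypothesis w_weight : weight w.

Lemma pr_ge0 A : 0 <= pr w A.
Proof. by apply: sumr_ge0 => x _; case: w_weight. Qed.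

Lemma pr_le (A B : pred X) : (forall x, A x -> B x) -> pr w A <= pr w B.
Proof.
move=> AB; rewrite /pr big_mkcond [leRHS]big_mkcond; apply: ler_sum => x _.
case: w_weight => w0 _; have := AB x.
by case: (A x) => [->//|_]; case: (B x).
Qed.

Lemma pr_predC A : pr w (predC A) = 1 - pr w A.
Proof.
case: w_weight => _ <-; rewrite /pr [in RHS](bigID A)/=.
by rewrite addrAC subrr add0r.
Qed.

Lemma pr_exists (K : finType) (P : pred K) (A : K -> pred X) :
  pr w (fun x => [exists k, P k && A k x]) <= \sum_(k | P k) pr w (A k).
Proof.
rewrite /pr (exchange_big_dep predT)//= big_mkcond/=; apply: ler_sum => x _.
case: w_weight => w0 _; case: existsP => [[k Pk]|_]; last exact: sumr_ge0.
by rewrite (bigD1 k)//= lerDl sumr_ge0.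
Qed.

Lemma pr_or (A B : pred X) : pr w (fun x => A x || B x) <= pr w A + pr w B.
Proof.
have <- : \sum_b pr w (if b then A else B) = pr w A + pr w B.
  by rewrite big_bool.
apply: le_trans (pr_exists _ _); apply: pr_le => x /orP ABx.
by apply/existsP; case: ABx => [Ax|Bx]; [exists true|exists false].
Qed.

Lemma pr_markov_exp (D : X -> R) (l s : R) : 0 <= l ->
  pr w (fun x => s < D x) <= expR (- (l * s)) * \sum_x w x * expR (l * D x).
Proof.
move=> l0; rewrite mulr_sumr /pr big_mkcond/=; apply: ler_sum => x _.
case: w_weight => w0 _; rewrite mulrCA -expRD; case: ifPn => [sD|_].
  by rewrite ler_peMr// -expR0 ler_expR -mulrN -mulrDr mulr_ge0// addrC subr_ge0 ltW.
by rewrite mulr_ge0// expR_ge0.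
Qed.

End pr.

Lemma prodw_mean (T : finType) (q : T -> R) n (g : 'I_n -> T -> R) :
  \sum_(x : {ffun 'I_n -> T}) prodw q x * \prod_i g i (x i) =
  \prod_i \sum_t q t * g i t.
Proof.
by rewrite bigA_distr_bigA/=; apply: eq_bigr => x _; rewrite -big_split.
Qed.

Lemma prodw_weight (T : finType) (q : T -> R) n :
  weight q -> weight (@prodw T q n).
Proof.
move=> [q0 q1]; split=> [x|]; first exact: prodr_ge0.
transitivity (\prod_(i < n) \sum_t q t * 1).
  by rewrite -prodw_mean; apply: eq_bigr => x _; rewrite big1_eq mulr1.
by rewrite big1// => i _; rewrite -[RHS]q1; apply: eq_bigr => t _; rewrite mulr1.
Qed.

Lemma expR_le_quad (y : R) : `|y| <= 2^-1 -> expR y <= 1 + y + 2 * y ^+ 2.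
Proof.
move=> /ler_normlP[y1 y2]; have := expR_ge1Dx (- y); rewrite expRN => h.
have e0 := expR_gt0 y; rewrite -(ler_pM2l (_ : 0 < 1 - y)); last lra.
have : (1 - y) * expR y <= 1 by rewrite -ler_pdivlMr// mul1r.
by move=> /le_trans; apply; nra.
Qed.

(** Chernoff's method with [expR_le_quad]. The bound is in terms of the variance
    [V] rather than the number of variables because the links of the chaining
    argument are sums with few nonzero terms. The range of [s] keeps the
    optimal parameter [s / (4 * V)] within the domain of [expR_le_quad]; in
    the applications the sum cannot exceed [2 * V]. *)
Lemma bernstein_tail (T : finType) (q : T -> R) n (Y : 'I_n -> T -> R) (V s : R) :
  weight q -> (forall i t, `|Y i t| <= 1) ->
  (forall i, \sum_t q t * Y i t = 0) ->
  \sum_i \sum_t q t * Y i t ^+ 2 <= V -> 0 < V -> 0 <= s <= 2 * V ->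
  pr (@prodw T q n) (fun x => s < \sum_i Y i (x i)) <= expR (- (s ^+ 2 / (8 * V))).
Proof.
move=> qw Y1 EY VY V0 /andP[s0 s2]; have [q0 q1] := qw.
pose l := s / (4 * V).
have l0 : 0 <= l by rewrite divr_ge0//; lra.
have l2 : l <= 2^-1 by rewrite ler_pdivrMr//; lra.
apply: le_trans (pr_markov_exp (prodw_weight _ qw) _ _ l0) _.
have -> : \sum_x prodw q x * expR (l * \sum_(i < n) Y i (x i)) =
    \prod_(i < n) \sum_t q t * expR (l * Y i t).
  rewrite -prodw_mean; apply: eq_bigr => x _.
  by rewrite mulr_sumr expR_sum.
have : \prod_(i < n) \sum_t q t * expR (l * Y i t) <=
    expR (2 * l ^+ 2 * \sum_i \sum_t q t * Y i t ^+ 2).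
  rewrite mulr_sumr expR_sum; apply: ler_prod => i _; apply/andP; split.
    by apply: sumr_ge0 => t _; rewrite mulr_ge0// expR_ge0.
  apply: le_trans (expR_ge1Dx _).
  have -> : 1 + 2 * l ^+ 2 * (\sum_t q t * Y i t ^+ 2) =
     \sum_t q t * (1 + l * Y i t + 2 * (l * Y i t) ^+ 2).
    transitivity (\sum_t q t + l * \sum_t q t * Y i t +
        2 * l ^+ 2 * \sum_t q t * Y i t ^+ 2); first by rewrite q1 EY; ring.
    by rewrite !mulr_sumr -!big_split/=; apply: eq_bigr => t _; ring.
  apply: ler_sum => t _; rewrite ler_wpM2l// expR_le_quad// normrM ger0_norm//.
  by rewrite (le_trans _ l2)// ler_piMr.
move=> /(ler_wpM2l (expR_ge0 (- (l * s)))) /le_trans; apply.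
rewrite -expRD ler_expR.
have : 2 * l ^+ 2 * (\sum_i \sum_t q t * Y i t ^+ 2) <= 2 * l ^+ 2 * V.
  by rewrite ler_wpM2l// mulr_ge0// sqr_ge0.
have -> : 2 * l ^+ 2 * V = s ^+ 2 / (8 * V) by rewrite /l; field; lra.
have -> : l * s = 2 * (s ^+ 2 / (8 * V)) by rewrite /l; field; lra.
by lra.
Qed.

Lemma bernstein_tail2 (T : finType) (q : T -> R) n (Y : 'I_n -> T -> R) (V s : R) :
  weight q -> (forall i t, `|Y i t| <= 1) ->
  (forall i, \sum_t q t * Y i t = 0) ->
  \sum_i \sum_t q t * Y i t ^+ 2 <= V -> 0 < V -> 0 <= s <= 2 * V ->
  pr (@prodw T q n) (fun x => s < `|\sum_i Y i (x i)|) <=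
    2 * expR (- (s ^+ 2 / (8 * V))).
Proof.
move=> qw Y1 EY VY V0 s02.
have H1 := bernstein_tail qw Y1 EY VY V0 s02.
have H2 : pr (@prodw T q n) (fun x => s < \sum_i - Y i (x i)) <=
    expR (- (s ^+ 2 / (8 * V))).
  apply: (bernstein_tail (Y := fun i t => - Y i t)) => // [i t|i|].
  - by rewrite normrN.
  - by under eq_bigr do rewrite mulrN; rewrite sumrN EY oppr0.
  - by under eq_bigr do under eq_bigr do rewrite sqrrN.
have := pr_or (prodw_weight n qw) (fun x => s < \sum_i Y i (x i))
  (fun x => s < \sum_i - Y i (x i)).
move=> /(le_trans _) H; apply: (le_trans (H _ _)); last first.
  by rewrite mulr_natl mulr2n lerD.
by apply: (pr_le (prodw_weight _ qw)) => x; rewrite ltr_normr sumrN.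
Qed.

End finite_probability.

(** * Vapnik-Chervonenkis dimension and packing numbers *)

Section vc.
Import mathcomp.boot.fintype mathcomp.boot.finset.

Section shattering.
Variable I : finType.
Implicit Types (F G : {set {set I}}) (S B f g : {set I}).

Definition shatters F S := powerset S \subset [set f :&: S | f in F].

Lemma shattersP F S : reflect
  (forall B, B \subset S -> exists2 f, f \in F & f :&: S = B) (shatters F S).
Proof.
apply: (iffP subsetP) => [H B BS|H B].
  have /imsetP[f fF ->] : B \in [set f :&: S | f in F].
    by apply: H; rewrite inE.
  by exists f.
by rewrite inE => /H[f fF <-]; apply/imsetP; exists f.
Qed.

Definition VC_le D F := forall S, shatters F S -> (#|S| <= D)%N.

Lemma shattersS F G S : F \subset G -> shatters F S -> shatters G S.
Proof.
move=> FG /shattersP H; apply/shattersP => B /H[f fF fB].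
by exists f => //; exact: (subsetP FG).
Qed.

Lemma VC_leS D F G : F \subset G -> VC_le D G -> VC_le D F.
Proof. by move=> FG H S /(shattersS FG)/H. Qed.

(** Pajor's form of the Sauer-Shelah lemma. Splitting [F] by membership of a
    point [x] separating two members, a set shattered by both halves is
    shattered by [F] together with its extension by [x], so that the
    number of shattered sets is superadditive. *)
Lemma card_le_shattered F : (#|F| <= #|[set S | shatters F S]|)%N.
Proof.
have [n] := ubnP #|F|; elim: n F => // n IH F Fn.
have [F1|/card_gt1P[f [g [fF gF fg]]]] := leqP #|F| 1.
  have [->|[f fF]] := set_0Vmem F; first by rewrite cards0.
  apply: (leq_trans F1); rewrite card_gt0; apply/set0Pn; exists set0.
  rewrite inE; apply/shattersP => B; rewrite subset0 => /eqP->.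
  by exists f; rewrite ?setI0.
have [x xfg] : exists x, (x \in f) != (x \in g).
  apply/existsP; apply: contraT; rewrite negb_exists => /forallP H.
  by case/eqP: fg; apply/setP => x; have := H x; rewrite negbK => /eqP.
pose F1 := [set h in F | x \in h]; pose F0 := [set h in F | x \notin h].
have F01 : (#|F0| + #|F1|)%N = #|F|.
  rewrite -(cardsID F1 F) addnC; by congr addn; apply: eq_card => h;
    rewrite !inE; case: (h \in F) => //=; rewrite ?andbT.
have F1n0 : (0 < #|F1|)%N.
  rewrite card_gt0; apply/set0Pn; move: xfg.
  by case xf: (x \in f); case xg: (x \in g) => // _; [exists f|exists g];
    rewrite inE ?xf ?xg ?fF ?gF.
have F0n0 : (0 < #|F0|)%N.
  rewrite card_gt0; apply/set0Pn; move: xfg.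
  by case xf: (x \in f); case xg: (x \in g) => // _; [exists g|exists f];
    rewrite inE ?xf ?xg ?fF ?gF.
have IH0 := IH F0; have IH1 := IH F1.
have {}IH0 : (#|F0| <= #|[set S | shatters F0 S]|)%N.
  by apply: IH; rewrite -ltnS (leq_trans _ Fn)// ltnS -F01 -addn1 leq_add2l.
have {}IH1 : (#|F1| <= #|[set S | shatters F1 S]|)%N.
  by apply: IH; rewrite -ltnS (leq_trans _ Fn)// ltnS -F01 -add1n leq_add2r.
set S0 := [set S | shatters F0 S] in IH0; set S1 := [set S | shatters F1 S] in IH1.
have xS0 S : S \in S0 -> x \notin S.
  rewrite inE => /shattersP/(_ S (subxx _))[h]; rewrite inE => /andP[_ xh] <-.
  by rewrite inE negb_and xh.
have xS1 S : S \in S1 -> x \notin S.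
  rewrite inE => /shattersP/(_ (S :\ x) (subsetDl _ _))[h].
  rewrite inE => /andP[_ xh] hS; have := in_setD1 x S x.
  by rewrite -hS inE xh eqxx/= => ->.
have sub0 : F0 \subset F by apply/subsetP => h; rewrite inE => /andP[].
have sub1 : F1 \subset F by apply/subsetP => h; rewrite inE => /andP[].
rewrite -F01 (leq_trans (leq_add IH0 IH1))// -cardsUI.
have <- : #|[set x |: S | S in S0 :&: S1]| = #|S0 :&: S1|.
  apply: card_in_imset => S S'; rewrite [in X in X -> _]inE => /andP[_ /xS1 xS].
  by rewrite inE => /andP[_ /xS1 xS'] E; rewrite -(setU1K xS) E setU1K.
rewrite -cardsUI (_ : _ :&: [set _ | _ in _] = set0) ?cards0 ?addn0; last first.
  apply/setP => S; rewrite !inE; apply/negP => /andP[SS /imsetP[S' _ SE]].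
  have : x \notin S by case/orP: SS => H; [apply: xS0|apply: xS1]; rewrite inE.
  by rewrite SE !inE eqxx.
apply: subset_leq_card; apply/subsetP => S; rewrite !inE => /orP[/orP[]|].
- exact: shattersS.
- exact: shattersS.
case/imsetP => S'; rewrite !inE => /andP[/shattersP H0 /shattersP H1 ->].
have xS' : x \notin S' by apply: xS1; rewrite inE; apply/shattersP.
apply/shattersP => B BS.
have BxS : B :\ x \subset S' by rewrite subDset.
have [xB|xB] := boolP (x \in B).
  have [h /[!inE]/andP[hF xh] hB] := H1 _ BxS; exists h => //.
  by rewrite setIUr hB -(setD1K xB); congr (_ :|: _);
    [apply/setIidPr; rewrite sub1set|rewrite setD1K].
have [h /[!inE]/andP[hF xh] hB] := H0 _ BxS; exists h => //.
rewrite setIUr hB; apply/setP => y; rewrite !inE.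
by case: eqVneq => [->|_]; rewrite ?(negPf xh) ?(negPf xB) ?andbF.
Qed.


End shattering.

(** The usual bound by a sum of binomial coefficients, in generating function
    form: each shattered set has at most [D] elements, hence weighs at least
    [x ^+ D] when a set [S] weighs [x ^+ #|S|]. *)
Lemma sauer_shelah (R : realType) (I : finType) D (F : {set {set I}}) (x : R) :
  VC_le D F -> 0 < x <= 1 -> #|F|%:R <= x ^- D * (1 + x) ^+ #|I|.
Proof.
move=> FD /andP[x0 x1]; rewrite ler_pdivlMl ?exprn_gt0//.
have -> : (1 + x) ^+ #|I| = \sum_(S : {set I}) x ^+ #|S|.
  rewrite addrC -prodr_const.
  rewrite (eq_bigl predT)// bigA_distr; apply: eq_bigr => S _.
  by rewrite -big_mkcond/= prodr_const.
have /le_trans : x ^+ D * #|F|%:R <= x ^+ D * #|[set S | shatters F S]|%:R.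
  by rewrite ler_wpM2l ?exprn_ge0 ?(ltW x0)// ler_nat card_le_shattered.
apply; rewrite mulr_natr -sumr_const big_mkcond/=; apply: ler_sum => S _.
rewrite inE; case: ifPn => [/FD SD|_]; last by rewrite exprn_ge0// ltW.
by rewrite ler_wiXn2l// ltW.
Qed.

Definition pullback (I J : finType) (u : J -> I) (F : {set {set I}}) :=
  [set u @^-1: f | f : {set I} in F].

Lemma VC_le_pullback (I J : finType) (u : J -> I) D (F : {set {set I}}) :
  VC_le D F -> VC_le D (pullback u F).
Proof.
move=> FD S /shattersP H.
have H' (B : {set J}) : B \subset S -> exists2 f, f \in F & (u @^-1: f) :&: S = B.
  by move=> /H[_ /imsetP[f fF ->] <-]; exists f.
have uS : {in S &, injective u}.
  move=> i j iS jS uij; have [|f fF E] := H' [set i]; first by rewrite sub1set.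
  have /setP/(_ i) := E; rewrite !inE eqxx uij => /andP[fj _].
  by have /setP/(_ j) := E; rewrite !inE fj jS => /esym/eqP.
rewrite -(card_in_imset uS); apply: FD; apply/shattersP => B BS.
have [f fF E] := H' (S :&: u @^-1: B) (subsetIl _ _).
exists f => //; apply/setP => i; rewrite inE.
have [/imsetP[j jS ->]|iS] := boolP (i \in u @: S).
  by have /setP/(_ j) := E; rewrite !inE jS andbT.
by rewrite andbF; apply/esym/negbTE; apply: contra iS; exact: (subsetP BS).
Qed.

Definition symdiff (I : finType) (f g : {set I}) := (f :\: g) :|: (g :\: f).

Section packing.
Variable R : realType.

Lemma pr_lt1_ex (X : finType) (w : X -> R) (A : pred X) :
  weight w -> pr w A < 1 -> exists x, ~~ A x.
Proof.
move=> [_ w1] A1; apply/existsP; apply: contraLR A1; rewrite negb_exists.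
move=> /forallP H; rewrite -leNgt -w1 /pr [leRHS](eq_bigl predT)// => x.
by have := H x; rewrite negbK.
Qed.

Lemma pr_avoid n (B : {set 'I_n}) m (e : R) : (0 < n)%N ->
  e * n%:R <= #|B|%:R ->
  pr (@prodw R 'I_n (fun=> n%:R^-1) m) (fun u => [forall k, u k \notin B]) <=
    expR (- (e * m%:R)).
Proof.
move=> n0 eB; have n0' : (0 : R) < n%:R by rewrite ltr0n.
have -> : pr (@prodw R 'I_n (fun=> n%:R^-1) m) (fun u => [forall k, u k \notin B])
    = \prod_(k < m) \sum_(t < n) n%:R^-1 * (t \notin B)%:R.
  rewrite -prodw_mean /pr big_mkcond/=; apply: eq_bigr => u _.
  case: forallP => [H|/forallP].
    by rewrite big1 ?mulr1// => k _; rewrite H.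
  rewrite negb_forall => /existsP[k]; rewrite negbK => kB.
  by rewrite [X in _ * X](bigD1 k)//= kB mul0r mulr0.
rewrite prodr_const card_ord -mulNr expRM_natr.
have -> : \sum_(t < n) n%:R^-1 * (t \notin B)%:R = 1 - #|B|%:R / n%:R :> R.
  rewrite -mulr_sumr -natr_sum.
  have -> : (\sum_(t < n) (t \notin B) = n - #|B|)%N.
    transitivity (#|'I_n| - #|B|)%N; last by rewrite card_ord.
    rewrite -(cardsC B) addKn -sum1_card [RHS]big_mkcond/=.
    by apply: eq_bigr => t _; rewrite inE; case: (t \in B).
  rewrite natrB; last by have := max_card B; rewrite card_ord.
  by field; rewrite pnatr_eq0 -lt0n.
rewrite lerXn2r ?nnegrE ?expR_ge0//.
  rewrite subr_ge0 ler_pdivrMr// mul1r ler_nat.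
  by have := max_card B; rewrite card_ord.
by apply: le_trans (expR_ge1Dx _); rewrite lerD2l lerN2 ler_pdivlMr.
Qed.

(** A sample of about [2 / e * ln #|G|] random indices meets, with positive
    probability, the symmetric difference of every pair in [G]. On such a sample
    the members of [G] leave distinct traces, and [sauer_shelah] at [x = e / 4]
    bounds their number by [(4 / e) ^+ D * sqrt #|G|] up to a constant. *)
Lemma packing n D (G : {set {set 'I_n}}) (e : R) : (0 < n)%N -> VC_le D G ->
  0 < e <= 1 ->
  {in G &, forall f g, f != g -> e * n%:R <= #|symdiff f g|%:R} ->
  #|G|%:R <= expR 1 * (4 / e) ^+ (2 * D).
Proof.
move=> n0 GD /andP[e0 e1] sep.
have [->|G0] := eqVneq G set0.
  by rewrite cards0 mulr_ge0// ?expR_ge0// exprn_ge0// divr_ge0// ltW.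
have M1 : (1 : R) <= #|G|%:R by rewrite ler1n card_gt0.
have M0 : (0 : R) < #|G|%:R by rewrite (lt_le_trans ltr01).
set M : R := #|G|%:R in M1 M0 *.
have lnM0 : 0 <= ln M by rewrite ln_ge0.
have y0 : 0 <= 2 * ln M / e by rewrite divr_ge0 ?(ltW e0)// mulr_ge0.
have [m m_gt m_le] : exists2 m : nat,
    2 * ln M / e < m%:R & m%:R <= 2 * ln M / e + 1.
  exists (Num.truncn (2 * ln M / e)).+1; first exact: truncnS_gt.
  by rewrite -natr1 lerD2r truncn_le.
pose q (_ : 'I_n) : R := n%:R^-1.
have qw : weight q.
  split=> [t|]; first by rewrite invr_ge0.
  by rewrite sumr_const card_ord -[LHS]mulr_natr mulVf// pnatr_eq0 -lt0n.
pose pairs (fg : {set 'I_n} * {set 'I_n}) :=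
  [&& fg.1 \in G, fg.2 \in G & fg.1 != fg.2].
pose avoid (fg : {set 'I_n} * {set 'I_n}) (u : {ffun 'I_m -> 'I_n}) :=
  [forall k, u k \notin symdiff fg.1 fg.2].
have : pr (@prodw R _ q m) (fun u => [exists fg, pairs fg && avoid fg u]) < 1.
  apply: le_lt_trans (pr_exists (prodw_weight _ qw) _ _) _.
  have : \sum_(fg | pairs fg) pr (@prodw R _ q m) (avoid fg) <=
      \sum_(fg | pairs fg) expR (- (e * m%:R)).
    apply: ler_sum => -[f g] /and3P[/= fG gG fg]; apply: pr_avoid => //.
    exact: sep.
  move=> /le_lt_trans; apply.
  have : \sum_(fg | pairs fg) expR (- (e * m%:R)) <= M ^+ 2 * expR (- (e * m%:R)).
    rewrite sumr_const -[leLHS]mulr_natl ler_wpM2r ?expR_ge0//.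
    rewrite expr2 -natrM ler_nat -cardsX; apply: subset_leq_card.
    by apply/subsetP => -[f g] /and3P[/= fG gG _]; rewrite inE fG gG.
  move=> /le_lt_trans; apply.
  rewrite -[M in M ^+ 2]lnK// -expRM_natl -expRD -[X in _ < X]expR0 ltr_expR.
  by move: m_gt; rewrite ltr_pdivrMr// mulrC; lra.
move=> /(pr_lt1_ex (prodw_weight _ qw))[u]; rewrite negb_exists => /forallP bad.
have uG : {in G &, injective (fun f : {set 'I_n} => u @^-1: f)}.
  move=> f g fG gG E; apply/eqP; apply: contraT => fg.
  have := bad (f, g); rewrite /pairs/= fG gG fg/= negb_forall => /existsP[k].
  have /setP/(_ k) := E; rewrite negbK !inE => ->.
  by case: (u k \in g).
have e4 : 0 < e / 4 <= 1 by apply/andP; split; lra.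
have HM := sauer_shelah (VC_le_pullback (u := u) GD) e4.
rewrite card_in_imset// card_ord -/M in HM.
have H1 : (1 + e / 4) ^+ m <= expR (ln M / 2 + 4^-1).
  have : (1 + e / 4) ^+ m <= expR (e / 4 * m%:R).
    rewrite expRM_natr lerXn2r ?nnegrE ?expR_ge0 ?expR_ge1Dx//.
    by rewrite addr_ge0// divr_ge0// ltW.
  move=> /le_trans; apply; rewrite ler_expR.
  have : e / 4 * m%:R <= e / 4 * (2 * ln M / e + 1) by rewrite ler_wpM2l//; lra.
  have -> : e / 4 * (2 * ln M / e + 1) = ln M / 2 + e / 4 by field; lra.
  by lra.
have a0 : 0 <= (4 / e) ^+ D by rewrite exprn_ge0// divr_ge0// ltW.
have H2 : M <= (4 / e) ^+ D * expR (ln M / 2 + 4^-1).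
  apply: (le_trans HM); rewrite -exprVn invf_div ler_wpM2l//.
have {}H2 : M * M <= M * (expR 1 * (4 / e) ^+ (2 * D)).
  have -> : M * (expR 1 * (4 / e) ^+ (2 * D)) =
     (4 / e) ^+ D ^+ 2 * expR (ln M + 1).
    by rewrite expRD lnK// mulnC exprM; ring.
  have : M ^+ 2 <= ((4 / e) ^+ D * expR (ln M / 2 + 4^-1)) ^+ 2.
    by rewrite lerXn2r// nnegrE ?(ltW M0)// mulr_ge0 ?expR_ge0.
  rewrite expr2 => /le_trans; apply.
  rewrite exprMn -expRM_natl ler_wpM2l ?sqr_ge0// ler_expR; lra.
by rewrite ler_pM2l in H2.
Qed.

End packing.
End vc.

(** * Chaining for sums of random signs *)

Section chaining.
Import mathcomp.boot.fintype mathcomp.boot.finset.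
Variable R : realType.

Definition coin (b : bool) : R := 2^-1.

Lemma coin_weight : weight coin.
Proof. by split=> [b|]; rewrite /coin ?big_bool /=; lra. Qed.

(** [s i] is the exponent of the sign attached to the index [i]. *)
Definition signed_sum n (f : {set 'I_n}) (s : {ffun 'I_n -> bool}) : R :=
  \sum_(i in f) (-1) ^+ s i.

Lemma signed_sumB n (f g : {set 'I_n}) (s : {ffun 'I_n -> bool}) :
  signed_sum f s - signed_sum g s =
  \sum_i ((i \in f)%:R - (i \in g)%:R) * (-1) ^+ s i.
Proof.
rewrite /signed_sum [in LHS]big_mkcond [X in _ - X]big_mkcond -sumrB.
apply: eq_bigr => i _.
by case: (i \in f); case: (i \in g); rewrite ?subrr ?mul0r ?subr0 ?mul1r ?sub0r ?mulN1r.
Qed.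

Lemma symdiff_card n (f g : {set 'I_n}) :
  \sum_i ((i \in f)%:R - (i \in g)%:R) ^+ 2 = #|symdiff f g|%:R :> R.
Proof.
rewrite -sum1_card natr_sum [RHS]big_mkcond/=; apply: eq_bigr => i _.
rewrite !inE.
by case: (i \in f); case: (i \in g); rewrite ?subrr ?subr0 ?sub0r ?expr0n ?sqrrN ?expr1n.
Qed.

Lemma signed_sum_link n (f g : {set 'I_n}) (V s : R) :
  #|symdiff f g|%:R <= V -> 0 < V -> 0 <= s ->
  pr (@prodw R _ coin n) (fun x => s < `|signed_sum f x - signed_sum g x|) <=
  2 * expR (- (s ^+ 2 / (8 * V))).
Proof.
move=> fgV V0 s0.
pose Y i (b : bool) : R := ((i \in f)%:R - (i \in g)%:R) * (-1) ^+ b.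
have c1 i : `|(i \in f)%:R - (i \in g)%:R| <= 1 :> R.
  by case: (_ \in f); case: (_ \in g); rewrite ?subrr ?subr0 ?sub0r ?normrN ?normr0 ?normr1.
have Y1 i b : `|Y i b| <= 1 by rewrite normrM normrX normrN1 expr1n mulr1.
have [s2|s2] := leP s (2 * V); last first.
  rewrite (_ : pr _ _ = 0); first by rewrite mulr_ge0// expR_ge0.
  rewrite /pr big_pred0// => x; apply/negbTE; rewrite -leNgt signed_sumB.
  apply: le_trans (ler_norm_sum _ _ _) _.
  suff : \sum_i `|((i \in f)%:R - (i \in g)%:R) * (-1) ^+ x i| <= V by lra.
  apply: le_trans fgV; rewrite -symdiff_card; apply: ler_sum => i _.
  rewrite normrM normrX normrN1 expr1n mulr1.
  by case: (_ \in f); case: (_ \in g);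
    rewrite ?subrr ?subr0 ?sub0r ?normrN ?normr0 ?normr1 ?sqrrN ?expr1n ?expr0n.
have := @bernstein_tail2 R _ coin n Y V s coin_weight Y1.
rewrite /pr => H; under eq_bigl do rewrite signed_sumB.
apply: H => // [i||].
- by rewrite big_bool /Y /coin/=; lra.
- apply: le_trans fgV; rewrite -symdiff_card; apply: ler_sum => i _.
  by rewrite big_bool /Y /coin/=; lra.
- by rewrite s0.
Qed.

Definition separated n (e : R) (G : {set {set 'I_n}}) :=
  {in G &, forall f g, f != g -> e * n%:R <= #|symdiff f g|%:R}.

(** A separated subset of maximal size is a net. The distance to the net is
    strictly below the scale except for points of the net itself; thus a net at a
    scale at which [e * n%:R < 1] is the whole family. *)
Lemma exists_net n (e : R) (F : {set {set 'I_n}}) :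
  0 < e -> exists2 G : {set {set 'I_n}},
  G \subset F & separated e G /\
  (forall f, f \in F -> exists2 g, g \in G & #|symdiff f g|%:R <= e * n%:R /\
     (f <> g -> #|symdiff f g|%:R < e * n%:R)).
Proof.
move=> e0.
pose sep (G : {set {set 'I_n}}) := [forall f in G, forall g in G, (f != g) ==>
  (e * n%:R <= #|symdiff f g|%:R)].
have sepP (G : {set {set 'I_n}}) : reflect (separated e G) (sep G).
  apply: (iffP forall_inP) => [H f g fG gG fg|H f fG].
    by have /forall_inP/(_ _ gG)/implyP := H _ fG; exact.
  by apply/forall_inP => g gG; apply/implyP; exact: H.
have sep0 : sep set0 && (set0 \subset F).
  by rewrite sub0set andbT; apply/sepP => f g; rewrite inE.
have [G /andP[/sepP Gsep GF] Gmax] :=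
  @arg_maxnP _ set0 (fun G => sep G && (G \subset F)) (fun G => #|G|) sep0.
exists G => //; split=> // f fF.
have en0 : 0 <= e * n%:R by rewrite mulr_ge0// ltW.
have sdff : #|symdiff f f| = 0%N by rewrite /symdiff setDv setU0 cards0.
have [fG|fG] := boolP (f \in G); first by exists f => //; rewrite sdff.
have [g gG fg] : exists2 g, g \in G & #|symdiff f g|%:R < e * n%:R.
  apply/exists_inP; apply: contraT; rewrite negb_exists => /forallP H.
  have sepfG : sep (f |: G).
    apply/sepP => g h; rewrite !inE.
    have far (k : {set 'I_n}) : k \in G -> e * n%:R <= #|symdiff f k|%:R.
      by move=> kG; have := H k; rewrite kG/= -leNgt.
    move=> /orP[/eqP->|gG] /orP[/eqP->|hG]; rewrite ?eqxx// => gh.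
    - exact: far.
    - by rewrite /symdiff setUC; exact: far.
    - exact: Gsep.
  have := Gmax (f |: G); rewrite sepfG subUset sub1set fF GF => /(_ isT)/=.
  by rewrite cardsU1 fG add1n ltnn.
by exists g => //; split => //; exact: ltW.
Qed.

Section chain.
Variables (n D : nat) (L : R) (F : {set {set 'I_n}}).
Hypotheses (n0 : (0 < n)%N) (D0 : (0 < D)%N) (L0 : 0 <= L) (FD : VC_le D F).

Let u := Num.sqrt (n%:R * (D%:R + L)).
(* The factor [2 ^- j] is the square root of the scale; [j.+1] pays for the union
   bound over the net, whose logarithm is of order [j.+1]. *)
Let step j := 16 * j.+1%:R * 2 ^- j * u.

(** Union bound over the links of one level: with [k = j.+1] the exponent of the
    single-link tail is [8 k^2 (D + L)], against [1 + 4 D k] for the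
    logarithm of the size of the net. *)
Lemma chain_level j (G : {set {set 'I_n}}) (proj : {set 'I_n} -> {set 'I_n}) :
  G \subset F -> separated (4 ^- j) G ->
  {in G, forall f, #|symdiff f (proj f)|%:R <= 4 * 4 ^- j * n%:R :> R} ->
  \sum_(f in G) pr (@prodw R _ coin n)
    (fun x => step j < `|signed_sum f x - signed_sum (proj f) x|) <=
  expR (- L) * 2 ^- j.+1.
Proof.
move=> GF Gsep Gproj.
have n0' : (0 : R) < n%:R by rewrite ltr0n.
have D1 : (1 : R) <= D%:R by rewrite ler1n.
have j0 : (0 : R) < 4 ^- j by rewrite invr_gt0 exprn_gt0.
have u2 : u ^+ 2 = n%:R * (D%:R + L) by rewrite sqr_sqrtr// mulr_ge0// addr_ge0.
have step0 : 0 <= step j.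
  by rewrite /step !mulr_ge0// ?invr_ge0 ?exprn_ge0// sqrtr_ge0.
have V0 : 0 < 4 * 4 ^- j * n%:R :> R by rewrite !mulr_gt0.
have E : step j ^+ 2 / (8 * (4 * 4 ^- j * n%:R)) = 8 * j.+1%:R ^+ 2 * (D%:R + L).
  rewrite /step !exprMn u2 -exprVn -exprM mulnC exprM exprVn.
  rewrite (_ : (2 : R) ^+ 2 = 4); last by ring.
  rewrite exprVn; field; rewrite ?expf_neq0 ?lt0r_neq0//=.
have : \sum_(f in G) pr (@prodw R _ coin n)
    (fun x => step j < `|signed_sum f x - signed_sum (proj f) x|) <=
    \sum_(f in G) 2 * expR (- (8 * j.+1%:R ^+ 2 * (D%:R + L))).
  by apply: ler_sum => f fG; rewrite -E; apply: signed_sum_link => //; exact: Gproj.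
move=> /le_trans; apply.
rewrite sumr_const -[leLHS]mulr_natl.
have e2 : (2 : R) <= expR 1 by apply: le_trans (expR_ge1Dx 1).
have Gle : #|G|%:R <= expR (1 + 4 * D%:R * j.+1%:R : R).
  have e01 : 0 < (4 : R) ^- j <= 1.
    by rewrite j0 invf_le1 ?exprn_gt0// exprn_ege1//; lra.
  apply: le_trans (packing n0 (VC_leS GF FD) e01 Gsep) _.
  rewrite expRD ler_wpM2l ?expR_ge0//.
  rewrite invrK -exprS -exprM -{1}(_ : (2 : R) ^+ 2 = 4); last by ring.
  rewrite -exprM.
  have -> : 4 * D%:R * j.+1%:R = (2 * (j.+1 * (2 * D)))%:R * 1 :> R.
    by rewrite !natrM; ring.
  by rewrite expRM_natl lerXn2r ?nnegrE ?expR_ge0.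
have : #|G|%:R * (2 * expR (- (8 * j.+1%:R ^+ 2 * (D%:R + L)))) <=
    expR (1 + 4 * D%:R * j.+1%:R) * (2 * expR (- (8 * j.+1%:R ^+ 2 * (D%:R + L)))).
  by rewrite ler_wpM2r// mulr_ge0// expR_ge0.
move=> /le_trans; apply.
rewrite ler_pdivlMr ?exprn_gt0//.
have -> : expR (1 + 4 * D%:R * j.+1%:R) *
    (2 * expR (- (8 * j.+1%:R ^+ 2 * (D%:R + L)))) * 2 ^+ j.+1 =
  expR (1 + 4 * D%:R * j.+1%:R - 8 * j.+1%:R ^+ 2 * (D%:R + L)) * 2 ^+ j.+2.
  by rewrite [in RHS]expRD [2 ^+ j.+2]exprS; ring.
have : 2 ^+ j.+2 <= expR (j.+2%:R : R).
  by rewrite -[j.+2%:R]mulr1 expRM_natl lerXn2r ?nnegrE ?expR_ge0.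
move=> /(ler_wpM2l (expR_ge0 (1 + 4 * D%:R * j.+1%:R - 8 * j.+1%:R ^+ 2 * (D%:R + L)))).
move=> /le_trans; apply; rewrite -expRD ler_expR -[j.+2%:R]natr1.
have k1 : (1 : R) <= j.+1%:R by rewrite ler1n.
set k : R := j.+1%:R in k1 *.
have kD : k <= k * D%:R by rewrite ler_peMr//; lra.
have kkD : k * D%:R <= k ^+ 2 * D%:R by rewrite ler_wpM2r// expr2 ler_peMl//; lra.
have kkL : L <= k ^+ 2 * L by rewrite ler_peMl// exprn_ege1.
by have := L0; lra.
Qed.

(* The closed form of the sum of [step i] for [i <= j]. *)
Let total j := 16 * u * (4 - (j + 3)%:R * 2 ^- j).

(** Dudley's chaining. At scale [4 ^- j] the net has [expR (O ((j + 1) D))] elements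
    (lemma [packing]), its links have variance [O (4 ^- j n)], and the deviation
    [step j] allowed to them is both summable in [j] and large enough for the
    union bound over the net. *)
Lemma chain j : exists2 G : {set {set 'I_n}}, G \subset F &
  (forall f, f \in F -> exists2 g, g \in G & #|symdiff f g|%:R <= 4 ^- j * n%:R :> R /\
     (f <> g -> #|symdiff f g|%:R < 4 ^- j * n%:R :> R)) /\
  pr (@prodw R _ coin n)
     (fun x => [exists f in G, total j < `|signed_sum f x|]) <=
  expR (- L) * (1 - 2 ^- j.+1).
Proof.
have pos i : (0 : R) < 4 ^- i by rewrite invr_gt0 exprn_gt0.
elim: j => [|j [G0 G0F [G0net IH]]].
  have [G GF [Gsep Gnet]] := exists_net F (pos 0%N).
  exists G => //; split=> //.
  have := @chain_level 0 G (fun=> set0) GF Gsep _.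
  have -> : total 0 = step 0 by rewrite /total /step expr0 invr1 add0n; ring.
  have -> : expR (- L) * (1 - 2 ^- 1) = expR (- L) * 2 ^- 1 by field.
  move=> H; apply: le_trans (H _) => [|f fG].
    apply: le_trans (pr_exists (prodw_weight _ coin_weight) _ _) _.
    apply: ler_sum => f _; apply: (pr_le (prodw_weight _ coin_weight)) => x.
    by rewrite [signed_sum set0 x]big_set0 subr0.
  rewrite expr0 invr1 mulr1 (@le_trans _ _ n%:R)//.
    by rewrite ler_nat -[leqRHS](card_ord n) max_card.
  by rewrite ler_peMl//; lra.
have [G GF [Gsep Gnet]] := exists_net F (pos j.+1).
exists G => //; split=> //.
pose proj f := if [pick g in G0 | #|symdiff f g|%:R <= 4 ^- j * n%:R :> R] is Some g
  then g else set0.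
have projP f : f \in F -> proj f \in G0 /\
    #|symdiff f (proj f)|%:R <= 4 * 4 ^- j.+1 * n%:R :> R.
  move=> /G0net[g gG0 [fg _]]; rewrite /proj; case: pickP => [h /andP[hG0 fh]|/(_ g)].
    split=> //; suff -> : 4 * 4 ^- j.+1 = 4 ^- j :> R by [].
    by rewrite exprS; field; rewrite expf_neq0.
  by rewrite gG0 fg.
have := @chain_level j.+1 G proj GF Gsep _.
move=> H; have {}H := H (fun f fG => (projP _ (subsetP GF _ fG)).2).
have : expR (- L) * (1 - 2 ^- j.+1) + expR (- L) * 2 ^- j.+2 <=
    expR (- L) * (1 - 2 ^- j.+2).
  rewrite -mulrDr ler_wpM2l ?expR_ge0//.
  have -> : 2 ^- j.+2 = 2 ^- j.+1 / 2 :> R by rewrite [2 ^+ j.+2]exprS invfM mulrC.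
  lra.
apply: le_trans; apply: le_trans (lerD IH H).
apply: le_trans; last first.
  by apply: lerD (lexx _) _; exact: (pr_exists (prodw_weight _ coin_weight)).
apply: le_trans (pr_or (prodw_weight _ coin_weight) _ _).
apply: (pr_le (prodw_weight _ coin_weight)) => x /exists_inP[f fG fx].
apply/orP; have [pG0 _] := projP _ (subsetP GF _ fG).
have [|far] := ltP (step j.+1) `|signed_sum f x - signed_sum (proj f) x|.
  by right; apply/existsP; exists f; rewrite fG.
left; apply/exists_inP; exists (proj f) => //.
have totalS : total j.+1 = total j + step j.+1.
  rewrite /total /step [2 ^+ j.+1]exprS !natrD -!natr1; field.
  by rewrite expf_neq0.
have := ler_normD (signed_sum f x - signed_sum (proj f) x) (signed_sum (proj f) x).
by rewrite subrK; rewrite totalS in fx; lra.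
Qed.

(** At level [n] of the chain the net is [F] itself, because [4 ^- n * n < 1]. *)
Lemma rademacher_maximal :
  pr (@prodw R _ coin n) (fun x => [exists f in F, 64 * u < `|signed_sum f x|]) <=
  expR (- L).
Proof.
have [G GF [Gnet]] := chain n.
have -> : G = F.
  apply/eqP; rewrite eqEsubset GF; apply/subsetP => f fF.
  have [g gG [_ fg]] := Gnet f fF.
  have [-> //|/eqP ne] := eqVneq f g.
  have n4 : 4 ^- n * n%:R < 1 :> R.
    by rewrite mulrC ltr_pdivrMr ?exprn_gt0// mul1r -natrX ltr_nat ltn_expl.
  have := lt_trans (fg ne) n4; rewrite -[1]/(1%:R) ltr_nat ltnS leqn0 cards_eq0.
  by rewrite /symdiff setU_eq0 !setD_eq0 -eqEsubset => /eqP.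
have total_le : total n <= 64 * u.
  rewrite /total; have : 0 <= u * ((n + 3)%:R * 2 ^- n).
    by rewrite !mulr_ge0 ?sqrtr_ge0// invr_ge0 exprn_ge0.
  lra.
move=> H; apply: le_trans (_ : expR (- L) * (1 - 2 ^- n.+1) <= _); last first.
  by rewrite ler_piMr ?expR_ge0// gerBl invr_ge0 exprn_ge0.
apply: le_trans H; apply: (pr_le (prodw_weight _ coin_weight)) => x.
move=> /exists_inP[f fF fx]; apply/exists_inP; exists f => //.
exact: le_lt_trans fx.
Qed.

End chain.
End chaining.

(** * Symmetrization and uniform deviations on a finite space *)

Section symmetrization.
Import mathcomp.boot.fintype mathcomp.boot.finset.
Variable R : realType.

Lemma pair_weight (X Y : finType) (w : X -> R) (w' : Y -> R) :
  weight w -> weight w' -> weight (fun z : X * Y => w z.1 * w' z.2).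
Proof.
move=> [w0 w1] [w'0 w'1]; split=> [z|]; first exact: mulr_ge0.
rewrite -(pair_bigA _ (fun x y => w x * w' y))/= -w1.
by apply: eq_bigr => x _; rewrite -mulr_sumr w'1 mulr1.
Qed.

Section ghost.
Variables (T : finType) (q : T -> R) (n : nat).
Let sample := {ffun 'I_n -> T}.
Let W : sample -> R := prodw q (n := n).

Definition swap (s : {ffun 'I_n -> bool}) (z : sample * sample) : sample * sample :=
  ([ffun i => if s i then z.2 i else z.1 i], [ffun i => if s i then z.1 i else z.2 i]).

Lemma swapK s : involutive (swap s).
Proof.
by move=> [x y]; congr pair; apply/ffunP => i; rewrite !ffunE/=; case: (s i).
Qed.

Lemma swap_weight s z : W (swap s z).1 * W (swap s z).2 = W z.1 * W z.2.
Proof.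
rewrite /W /prodw -!big_split/=; apply: eq_bigr => i _; rewrite !ffunE.
by case: (s i) => //; rewrite mulrC.
Qed.

(** Exchanging the i-th points of the two samples does not change their joint
    law, so the coin tosses deciding about the exchanges may be averaged over
    first, with both samples fixed. *)
Lemma pr_swap (A : pred (sample * sample)) (r : R) : weight q ->
  (forall z, pr (prodw (@coin R) (n := n)) (fun s => A (swap s z)) <= r) ->
  pr (fun z => W z.1 * W z.2) A <= r.
Proof.
move=> qw H; have [W0 W1] := pair_weight (prodw_weight n qw) (prodw_weight n qw).
have [c0 c1] := prodw_weight n (coin_weight R).
have -> : pr (fun z => W z.1 * W z.2) A = \sum_s prodw (@coin R) s *
    \sum_z W z.1 * W z.2 * (A (swap s z))%:R.
  rewrite -[LHS]mul1r -[X in X * _]c1 mulr_suml; apply: eq_bigr => s _; congr (_ * _).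
  rewrite /pr big_mkcond/= (reindex_inj (inv_inj (swapK s))).
  by apply: eq_bigr => z _; rewrite swap_weight; case: (A _); rewrite ?mulr1 ?mulr0.
apply: (@le_trans _ _ (\sum_z W z.1 * W z.2 * r)); last first.
  by rewrite -mulr_suml W1 mul1r.
under eq_bigr do rewrite mulr_sumr; rewrite exchange_big/=.
apply: ler_sum => z _; apply: le_trans (_ : _ <= W z.1 * W z.2 *
    pr (prodw (@coin R) (n := n)) (fun s => A (swap s z))) _; last first.
  by rewrite ler_wpM2l// W0.
rewrite /pr [in leRHS]big_mkcond/= mulr_sumr; apply: ler_sum => s _.
by case: (A _); rewrite ?mulr1 ?mulr0// mulrC.
Qed.

End ghost.

Section deviation.
Variables (T K : finType) (q : T -> R) (n : nat) (A : K -> pred T).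
Hypothesis qw : weight q.
Let sample := {ffun 'I_n -> T}.
Let W : sample -> R := prodw q (n := n).

Definition deviation k (x : sample) : R :=
  \sum_i ((A k (x i))%:R - pr q (A k)).

Lemma pr_in01 k : 0 <= pr q (A k) <= 1.
Proof.
rewrite pr_ge0//=; case: qw => q0 <-; rewrite /pr big_mkcond/=.
by apply: ler_sum => t _; case: ifP.
Qed.

Lemma deviation_le k x : `|deviation k x| <= n%:R.
Proof.
apply: le_trans (ler_norm_sum _ _ _) _.
rewrite -[leRHS]mulr1 -[in leRHS](card_ord n) mulr_natl -sumr_const.
apply: ler_sum => i _; have /andP[p0 p1] := pr_in01 k.
by rewrite ler_norml; case: (A k (x i)); rewrite /=; lra.
Qed.

Lemma deviation_tail k (s : R) : (0 < n)%N -> 0 <= s <= 2 * n%:R ->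
  pr W (fun x => s < `|deviation k x|) <= 2 * expR (- (s ^+ 2 / (8 * n%:R))).
Proof.
move=> n0 s2; have /andP[p0 p1] := pr_in01 k.
have Y1 (b : bool) : `|b%:R - pr q (A k)| <= 1.
  by rewrite ler_norml; case: b; rewrite /=; lra.
pose Y (i : 'I_n) t : R := (A k t)%:R - pr q (A k).
apply: (@bernstein_tail2 R T q n Y n%:R s) => // [i t|i||].
- exact: Y1.
- rewrite /Y; under eq_bigr do rewrite mulrBr.
  case: qw => _ q1; rewrite sumrB -mulr_suml q1 mul1r; apply/eqP; rewrite subr_eq0.
  rewrite /pr [in X in _ == X]big_mkcond/=; apply/eqP; apply: eq_bigr => t _.
  by case: (A k t); rewrite ?mulr1 ?mulr0.
- rewrite -[leRHS]mulr1 -[in leRHS](card_ord n) mulr_natl -sumr_const.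
  apply: ler_sum => i _; case: qw => q0 <-; apply: ler_sum => t _.
  by rewrite ler_piMr// -[leLHS]ger0_norm ?sqr_ge0// normrX expr_le1//; exact: Y1.
- by rewrite ltr0n.
Qed.

(** If the sample deviates by more than [s] at some [k], an independent second
    sample deviates at the same [k] by at most [s / 2] with probability at least
    one half, and then the two deviations differ by more than [s / 2]. *)
Lemma ghost_sample (s : R) : 0 <= s ->
  (forall k, pr W (fun x => s / 2 < `|deviation k x|) <= 2^-1) ->
  pr W (fun x => [exists k, s < `|deviation k x|]) <=
  2 * pr (fun z => W z.1 * W z.2)
    (fun z => [exists k, s / 2 < `|deviation k z.1 - deviation k z.2|]).
Proof.
move=> s0 half; have Ww := prodw_weight n qw.
rewrite -ler_pdivrMl// mulrC /pr [leRHS]big_mkcond/= .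
rewrite -(pair_bigA _ (fun x y => if [exists k, s / 2 < `|deviation k x - deviation k y|]
   then W x * W y else 0))/= [in leLHS]big_mkcond mulr_suml.
apply: ler_sum => x _; case: ifPn => [/existsP[k kx]|_]; last first.
  by rewrite mul0r sumr_ge0// => y _; case: ifP => // _; case: Ww => W0 _; rewrite mulr_ge0.
have : W x / 2 <= W x * pr W (predC (fun y => s / 2 < `|deviation k y|)).
  rewrite ler_wpM2l//; first by case: Ww.
  by rewrite pr_predC//; have := half k; lra.
move=> /le_trans; apply; rewrite /pr [in leLHS]big_mkcond/= mulr_sumr; apply: ler_sum => y _.
have W0 : 0 <= W x * W y by case: Ww => W0 _; rewrite mulr_ge0.
case: ifPn => /=; last by case: ifP; rewrite mulr0.
rewrite -leNgt => ky; case: existsP => // -[]; exists k.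
by have := lerB_dist (deviation k x) (deviation k y); lra.
Qed.

Variables (D : nat) (L : R).
Hypotheses (n0 : (0 < n)%N) (D0 : (0 < D)%N) (L0 : 0 <= L).
Hypothesis AD : forall x : sample,
  VC_le D [set [set i | A k (x i)] | k in [set: K]].

(** After symmetrization the two samples are fixed and [rademacher_maximal]
    applies to the traces of the class on each of them. It is used at the
    level [L + 2], since [4 * expR (- 2) <= 1] absorbs the factor [2] of
    [ghost_sample] and the two samples. *)
Lemma uniform_deviation :
  pr W (fun x => [exists k, 512 * Num.sqrt (n%:R * (D%:R + L)) < `|deviation k x|]) <=
  expR (- L).
Proof.
have Ww := prodw_weight n qw.
set u := Num.sqrt _; set s := 512 * u.
have u0 : 0 <= u := sqrtr_ge0 _.
have s0 : 0 <= s by rewrite mulr_ge0 ?ler0n.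
have n0' : (0 : R) < n%:R by rewrite ltr0n.
have D1 : (1 : R) <= D%:R by rewrite ler1n.
have [sn|ns] := ltP n%:R s.
  rewrite /pr big_pred0 ?expR_ge0// => x; apply/negbTE; rewrite negb_exists.
  by apply/forallP => k; rewrite -leNgt (le_trans (deviation_le _ _))// ltW.
have u2 : u ^+ 2 = n%:R * (D%:R + L).
  by rewrite sqr_sqrtr// mulr_ge0// addr_ge0.
apply: le_trans (ghost_sample s0 _) _ => [k|].
  apply: le_trans (deviation_tail k n0 _) _; first by apply/andP; split; lra.
  have -> : (s / 2) ^+ 2 / (8 * n%:R) = 8192 * (D%:R + L).
    by rewrite /s !exprMn u2; field; rewrite pnatr_eq0 -lt0n.
  rewrite -ler_pdivlMl// expRN -invfM lef_pV2 ?posrE ?mulr_gt0 ?expR_gt0//.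
  have := expR_ge1Dx (8192 * (D%:R + L)); have := L0; lra.
have : 2 * pr (fun z => W z.1 * W z.2)
    (fun z => [exists k, s / 2 < `|deviation k z.1 - deviation k z.2|]) <=
    2 * (expR (- (L + 2)) + expR (- (L + 2))).
  rewrite ler_wpM2l//; apply: pr_swap => // z.
  pose tr (x : sample) := [set [set i | A k (x i)] | k in [set: K]].
  have L2 : 0 <= L + 2 by rewrite addr_ge0.
  have H1 := rademacher_maximal n0 D0 L2 (@AD z.1).
  have H2 := rademacher_maximal n0 D0 L2 (@AD z.2).
  apply: le_trans (lerD H1 H2); rewrite -/(tr z.1) -/(tr z.2).
  apply: le_trans (pr_or (prodw_weight _ (coin_weight R)) _ _).
  apply: (pr_le (prodw_weight _ (coin_weight R))) => x /existsP[k].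
  have -> : deviation k (swap x z).1 - deviation k (swap x z).2 =
      signed_sum R [set i | A k (z.1 i)] x - signed_sum R [set i | A k (z.2 i)] x.
    rewrite signed_sumB /deviation -sumrB; apply: eq_bigr => i _.
    by rewrite !ffunE !inE; case: (x i); rewrite /= ?expr0 ?expr1; ring.
  move=> kx.
  have u' : 64 * Num.sqrt (n%:R * (D%:R + (L + 2))) <= s / 4.
    rewrite (_ : s / 4 = 64 * (2 * u)); last by rewrite /s; field.
    rewrite ler_wpM2l// -[2 * u]ger0_norm ?mulr_ge0// -sqrtr_sqr ler_wsqrtr//.
    rewrite exprMn u2 mulrCA ler_wpM2l//.
    by have := L0; lra.
  have kin (y : sample) : [set i | A k (y i)] \in tr y by rewrite imset_f.
  apply/orP.
  have [|far] := ltP (64 * Num.sqrt (n%:R * (D%:R + (L + 2))))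
     `|signed_sum R [set i | A k (z.1 i)] x|.
    by left; apply/exists_inP; exists [set i | A k (z.1 i)].
  right; apply/exists_inP; exists [set i | A k (z.2 i)] => //.
  have := ler_normB (signed_sum R [set i | A k (z.1 i)] x)
    (signed_sum R [set i | A k (z.2 i)] x).
  lra.
move=> /le_trans; apply.
have -> : expR (- (L + 2)) = expR (- L) * expR (- 2) by rewrite opprD expRD.
have : 4 * expR (- 2 : R) <= 1.
  rewrite expRN -ler_pdivlMr ?invr_gt0 ?expR_gt0// invrK mul1r.
  rewrite (_ : 2 = 2%:R * 1); last by rewrite mulr1.
  rewrite expRM_natl (_ : 4 = 2 ^+ 2); last by ring.
  by rewrite lerXn2r ?nnegrE ?expR_ge0//; apply: le_trans (expR_ge1Dx 1).
by have := expR_gt0 (- L); nra.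
Qed.

End deviation.
End symmetrization.

(** * Halfspaces and linear functionals *)

Section halfspaces.
Import mathcomp.boot.fintype mathcomp.boot.finset.
Variables (R : realType) (d : nat).

(** More than [d + 1] points of [R^d] admit a nontrivial relation with
    coefficients [a] of sum [0]. No halfspace contains exactly those
    with [a i > 0]: the relation would make a sum of nonnegative terms, not
    all zero, vanish. *)
Lemma VC_halfspaces n (x : 'I_n -> 'cV[R]_d) (K : finType) (v : K -> 'cV[R]_d)
    (c : K -> R) :
  VC_le d.+1 [set [set i | c k < dotp (v k) (x i)] | k in [set: K]].
Proof.
move=> S /shattersP shat; rewrite leqNgt; apply/negP => dS.
pose M := \matrix_(a < #|S|) row_mx (x (enum_val a))^T (-1)%:M : 'M[R]_(#|S|, d + 1).
have /rowV0Pn[a /sub_kermxP aM a0] : kermx M != 0.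
  rewrite kermx_eq0 /row_free neq_ltn (leq_ltn_trans (rank_leq_col M))//.
  by rewrite addn1.
have [b [j bj bM]] : exists b : 'rV[R]_(#|S|), exists2 j, 0 < b 0 j & b *m M = 0.
  have [j aj] : exists j, a 0 j != 0.
    apply/existsP; apply: contraNT a0; rewrite negb_exists => /forallP H.
    by apply/eqP/rowP => j; rewrite mxE; have := H j; rewrite negbK => /eqP.
  have [aj0|aj0|/eqP] := ltgtP (a 0 j) 0; last by rewrite (negPf aj).
    by exists (- a); exists j; rewrite ?mxE ?oppr_gt0// mulNmx aM oppr0.
  by exists a, j.
pose B := [set enum_val i | i in [set i | 0 < b 0 i]].
have BS : B \subset S.
  by apply/subsetP => _ /imsetP[i _ ->]; exact: enum_valP.
have [_ /imsetP[k _ ->] kB] := shat B BS.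
have E i : (c k < dotp (v k) (x (enum_val i))) = (0 < b 0 i).
  have /setP/(_ (enum_val i)) := kB; rewrite !inE enum_valP andbT => ->.
  apply/imsetP/idP => [[i' /[!inE] bi' /enum_val_inj->]//|bi].
  by exists i => //; rewrite inE.
pose w := col_mx (v k) (c k)%:M.
have Mw i : (M *m w) i 0 = dotp (v k) (x (enum_val i)) - c k.
  have /rowP/(_ 0) := row_mul i M w; rewrite mxE => ->.
  rewrite rowK mul_row_col mxE -scalar_mxM /dotp; congr (_ + _).
    by rewrite -{1}(trmxK (v k)) -trmx_mul mxE.
  by rewrite mxE mulr1n mulN1r.
have : (b *m (M *m w)) 0 0 = 0 by rewrite mulmxA bM mul0mx mxE.
rewrite mxE; apply/eqP; rewrite gt_eqF// (bigD1 j)//= ltr_pwDl//.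
  by rewrite Mw mulr_gt0// subr_gt0 E.
apply: sumr_ge0 => i _; rewrite Mw; have := E i.
case: ltP => vx /esym bi; first by rewrite mulr_ge0 ?ltW// subr_gt0.
by rewrite mulr_le0 ?subr_le0// leNgt bi.
Qed.

End halfspaces.

Section hahn_banach.
Variables (R : realType) (d : nat).
Implicit Types (p q : 'cV[R]_d -> R) (x y e : 'cV[R]_d).

Definition sublinear p :=
  (forall x y, p (x + y) <= p x + p y) /\
  (forall a x, 0 <= a -> p (a *: x) = a * p x).

Lemma sublinear0 p : sublinear p -> p 0 = 0.
Proof. by move=> [_ /(_ 0 0 (lexx _))]; rewrite scale0r mul0r. Qed.

(** The reduced functional is the infimum over [t >= 0] of
    [p (x + t *: e) - t * p e]; at [- e] its term [t = 1] equals [- p e]. *)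
Lemma sublinear_reduce p e : sublinear p ->
  exists q, [/\ sublinear q, forall x, q x <= p x & q (- e) <= - p e].
Proof.
move=> psub; have [pD pZ] := psub.
pose A x := [set p (x + t *: e) - t * p e | t in [set t | 0 <= t]]%classic.
have lbA x t : 0 <= t -> - p (- x) <= p (x + t *: e) - t * p e.
  by move=> t0; have := pD (x + t *: e) (- x); rewrite addrAC subrr add0r pZ//; lra.
have infA x : has_inf (A x).
  split; first by exists (p (x + 0 *: e) - 0 * p e), 0 => /=.
  by exists (- p (- x)) => _ [t t0 <-]; exact: lbA.
have leA x t : 0 <= t -> inf (A x) <= p (x + t *: e) - t * p e.
  by move=> t0; apply: ge_inf; [exact: (infA x).2|exists t].
have geA x r : (forall t, 0 <= t -> r <= p (x + t *: e) - t * p e) -> r <= inf (A x).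
  by move=> H; apply: lb_le_inf; [exact: (infA x).1|move=> _ [t t0 <-]; exact: H].
exists (fun x => inf (A x)); split; first split.
- move=> x y; rewrite -lerBlDr; apply: (geA) => t t0; rewrite lerBlDr -lerBlDl.
  apply: (geA) => s s0; rewrite lerBlDl.
  have ts0 : 0 <= t + s by rewrite addr_ge0.
  apply: le_trans (leA _ _ ts0) _.
  have := pD (x + t *: e) (y + s *: e).
  by rewrite addrACA -scalerDl; lra.
- have homo a x : 0 < a -> a * inf (A x) <= inf (A (a *: x)).
    move=> a0; apply: (geA) => t t0; rewrite -ler_pdivlMl//.
    have t0' : 0 <= a^-1 * t by rewrite mulr_ge0// invr_ge0 ltW.
    apply: le_trans (leA x _ t0') _.
    have -> : x + (a^-1 * t) *: e = a^-1 *: (a *: x + t *: e).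
      by rewrite scalerDr !scalerA mulVf ?scale1r// gt_eqF.
    by rewrite pZ ?invr_ge0 ?(ltW a0)// mulrBr mulrA.
  move=> a x; rewrite le_eqVlt => /predU1P[<-|a0].
    rewrite scale0r mul0r; apply/eqP; rewrite eq_le; apply/andP; split.
      apply: le_trans (leA 0 0 (lexx _)) _.
      by rewrite scale0r addr0 (sublinear0 psub) mul0r subr0.
    by apply: (geA) => t t0; rewrite add0r pZ// subrr.
  apply/eqP; rewrite eq_le homo// andbT -ler_pdivrMl//.
  by apply: le_trans (homo _ _ _) _; rewrite ?invr_gt0// scalerA mulVf ?scale1r// gt_eqF.
- by move=> x; apply: le_trans (leA x 0 (lexx _)) _; rewrite scale0r addr0 mul0r subr0.
- apply: le_trans (leA (- e) 1 ler01) _.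
  by rewrite scale1r addNr (sublinear0 psub) mul1r sub0r.
Qed.

(** A sublinear functional that is odd on the members of [es] is linear on
    their span. Oddness on one vector survives the reduction along another one,
    because reduction only decreases the functional. *)
Lemma sublinear_reduce_seq p (es : seq 'cV[R]_d) : sublinear p ->
  exists q, [/\ sublinear q, forall x, q x <= p x &
    forall e, e \in es -> q (- e) <= - q e].
Proof.
move=> psub; elim: es => [|e es [q [qsub qp qes]]]; first by exists p.
have [r [rsub rq re]] := sublinear_reduce e qsub; exists r; split=> //.
  by move=> x; exact: le_trans (rq x) (qp x).
move=> f; rewrite inE => /predU1P[->|fes].
  by apply: le_trans re _; rewrite lerN2 rq.
apply: le_trans (rq _) _; apply: le_trans (qes _ fes) _.
by rewrite lerN2 rq.
Qed.

Lemma dotp_col (v x : 'cV[R]_d) : dotp v x = \sum_i v i 0 * x i 0.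
Proof. by rewrite /dotp mxE; apply: eq_bigr => i _; rewrite mxE. Qed.

(** The functional is reduced along [z] first, which makes its value at [- z] at
    most [- p z], and then along the canonical basis, which makes it linear. *)
Lemma hahn_banach p z : sublinear p ->
  exists2 v, dotp v z = p z & forall x, dotp v x <= p x.
Proof.
move=> psub; have [q0 [q0sub q0p q0z]] := sublinear_reduce z psub.
have [q [qsub qq0 qe]] :=
  sublinear_reduce_seq [seq delta_mx i 0 | i <- enum 'I_d] q0sub.
have [qD qZ] := qsub.
pose v : 'cV[R]_d := \col_i q (delta_mx i 0).
have qv x : q x <= dotp v x.
  have -> : x = \sum_i x i 0 *: delta_mx i 0.
    apply/colP => i; rewrite summxE (bigD1 i)//= big1 => [|j ji].
      by rewrite !mxE !eqxx mulr1 addr0.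
    by rewrite !mxE eq_sym (negPf ji) mulr0.
  have -> : dotp v (\sum_i x i 0 *: delta_mx i 0) = \sum_i x i 0 * v i 0.
    rewrite dotp_col; apply: eq_bigr => i _; rewrite mulrC; congr (_ * _).
    rewrite summxE (bigD1 i)//= big1 => [|j ji].
      by rewrite !mxE !eqxx mulr1 addr0.
    by rewrite !mxE eq_sym (negPf ji) mulr0.
  have : forall s : seq 'I_d, q (\sum_(i <- s) x i 0 *: delta_mx i 0) <=
      \sum_(i <- s) x i 0 * v i 0.
    elim=> [|i s IH]; first by rewrite !big_nil (sublinear0 qsub).
    rewrite !big_cons; apply: le_trans (qD _ _) _; rewrite lerD//.
    have [xi|xi] := leP 0 (x i 0); first by rewrite qZ// mxE.
    rewrite -[x i 0]opprK scaleNr -scalerN qZ ?oppr_ge0 ?(ltW xi)//.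
    rewrite [leRHS]mulNr -mulrN ler_wpM2l ?oppr_ge0 ?(ltW xi)// mxE qe//.
    by apply/mapP; exists i; rewrite ?mem_enum.
  exact.
have vN x : dotp v (- x) = - dotp v x by rewrite /dotp mulmxN mxE.
have qN x : - q (- x) <= q x.
  by have := qD x (- x); rewrite subrr (sublinear0 qsub); lra.
have vp x : dotp v x <= p x.
  have := qv (- x); rewrite vN; have := qN x.
  by have := q0p x; have := qq0 x; lra.
exists v => //; apply/eqP; rewrite eq_le vp/=.
by have := qv z; have := qN z; have := qq0 (- z); lra.
Qed.

End hahn_banach.

(** * Deviations over countably many halfspaces *)

Local Open Scope classical_set_scope.
Local Open Scope ring_scope.

Section measurability.
Variables (R : realType) (d : nat).
Implicit Types (v : 'cV[R]_d) (c : R).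

Lemma continuous_dotp v : continuous (dotp v).
Proof.
have -> : dotp v = fun x => \sum_i v i 0 * x i 0.
  by apply/funext => x; rewrite dotp_col.
apply: (@continuous_big R 'I_d +%R 0 xpredT) => [x|i _ x].
  by apply: continuousD; [exact: cvg_fst|exact: cvg_snd].
by apply: continuousM; [exact: cst_continuous|exact: coord_continuous].
Qed.

Lemma measurable_open_halfspace v c : measurable [set x | c < dotp v x].
Proof.
apply: sub_sigma_algebra => /=.
apply: (@open_comp _ _ (dotp v) [set y | c < y]); last exact: open_gt.
by move=> x _; exact: continuous_dotp.
Qed.

Lemma dotpN v x : dotp (- v) x = - dotp v x.
Proof. by rewrite /dotp linearN/= mulNmx mxE. Qed.

Lemma measurable_closed_halfspace v c : measurable [set x | c <= dotp v x].
Proof.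
have -> : [set x | c <= dotp v x] = ~` [set x | - c < dotp (- v) x].
  apply/seteqP; split => x /=; rewrite dotpN ltrN2; first by rewrite ltNge => ->.
  by move=> vx; rewrite leNgt; apply/negP.
by apply: measurableC; exact: measurable_open_halfspace.
Qed.

End measurability.

Lemma measure_fintype_bigcup (disp : measure_display) (U : measurableType disp)
    (R : realType) (mu : {measure set U -> \bar R}) (T : finType) (B : pred T)
    (F : T -> set U) :
  (forall t, measurable (F t)) -> trivIset setT F ->
  mu (\bigcup_(t in [set` B]) F t) = (\sum_(t | B t) mu (F t))%E.
Proof.
move=> mF tF; rewrite measure_fin_bigcup//; last exact: sub_trivIset tF.
rewrite -(@bigfs _ _ _ _ (index_enum T))//=; first exact: index_enum_uniq.
by move=> t _; rewrite mem_index_enum.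
Qed.

Lemma probability_fineK (disp : measure_display) (U : measurableType disp)
    (R : realType) (P : probability U R) (A : set U) :
  measurable A -> ((fine (P A))%:E = P A)%E.
Proof. by move=> mA; rewrite fineK// fin_num_measure. Qed.

Section sampling.
Variables (R : realType) (d n : nat) (disp : measure_display)
  (Omega : measurableType disp) (P : probability Omega R)
  (p : probability 'cV[R]_d R) (X : 'I_n -> Omega -> 'cV[R]_d).
Hypothesis Xiid : iid P p X.

(** [n] times the difference between the empirical and the true mass of an open
    halfspace. *)
Definition halfspace_deviation (v : 'cV[R]_d) (c : R) (w : Omega) : R :=
  \sum_i ((c < dotp v (X i w))%R%:R - fine (p [set x | c < dotp v x])).

Section cells.
Variables (K : finType) (v : K -> 'cV[R]_d) (c : K -> R).

Definition cell (x : 'cV[R]_d) : {set K} := [set k | c k < dotp (v k) x]%SET.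

Definition cell_set (t : {set K}) : set 'cV[R]_d := [set x | cell x = t].

Definition cell_prob t : R := fine (p (cell_set t)).

(** A cell is represented by one of its points, because the dimension bound of
    [VC_halfspaces] speaks of halfspaces through points of the space. *)
Definition cell_in k t := c k < dotp (v k) (xget 0 (cell_set t)).

Lemma cell_inE k x : cell_in k (cell x) = (c k < dotp (v k) x).
Proof.
have /(xgetPex 0) : exists y, cell_set (cell x) y by exists x.
by move=> /setP/(_ k); rewrite !inE /cell_in => ->.
Qed.

Lemma measurable_cell_set t : measurable (cell_set t).
Proof.
pose H k := [set x | c k < dotp (v k) x].
have -> : cell_set t = \bigcap_(k in [set: K]) (if k \in t then H k else ~` H k).
  apply/seteqP; split => x /=.
    move=> <- k _; rewrite inE; case: ifPn => //= /negP; exact.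
  move=> h; apply/setP => k; rewrite inE; have := h k I.
  by case: (k \in t) => /= [->//|/negP/negbTE].
apply: fin_bigcap_measurable => // k _; rewrite /H; case: ifP => _.
  exact: measurable_open_halfspace.
by apply: measurableC; exact: measurable_open_halfspace.
Qed.

Lemma trivIset_cell_set : trivIset setT cell_set.
Proof. by apply/trivIsetP => s t _ _; apply: contraNeq => /set0P[x [<- <-]]. Qed.

Lemma sum_cell_prob (B : pred {set K}) :
  pr cell_prob B = fine (p [set x | B (cell x)]).
Proof.
have -> : [set x | B (cell x)] = \bigcup_(t in [set` B]) cell_set t.
  apply/seteqP; split => x /= => [Bx|[t Bt ->]//]; by exists (cell x).
rewrite measure_fintype_bigcup//; [|exact: measurable_cell_set|exact: trivIset_cell_set].
rewrite (eq_bigr (fun t => (cell_prob t)%:E)) => [|t _].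
  by rewrite sumEFin.
by rewrite probability_fineK//; exact: measurable_cell_set.
Qed.

Lemma cell_prob_weight : weight cell_prob.
Proof.
split=> [t|]; first by rewrite fine_ge0.
have := sum_cell_prob predT; rewrite /pr => ->.
by rewrite [X in p X](_ : _ = setT) ?probability_setT//; apply/seteqP; split.
Qed.

Definition sample_cells (w : Omega) : {ffun 'I_n -> {set K}} :=
  [ffun i => cell (X i w)].

(** Independence makes the joint law of the cells of the sample the product
    weight, so that events about cells have the probabilities of the finite
    model. *)
Lemma pr_sample_cells (B : pred {ffun 'I_n -> {set K}}) :
  measurable [set w | B (sample_cells w)] /\
  P [set w | B (sample_cells w)] = (pr (prodw cell_prob (n := n)) B)%:E.
Proof.
have [mX Xp Xind] := Xiid.
pose F (y : {ffun 'I_n -> {set K}}) := [set w | sample_cells w = y].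
have FE y : F y = \bigcap_(i in [set i | i \in [set: 'I_n]%SET])
    (X i @^-1` cell_set (y i)).
  apply/seteqP; split => w /= => [<- i _|h]; first by rewrite /cell_set/= ffunE.
  by apply/ffunP => i; rewrite ffunE; apply: h; rewrite /= inE.
have mF y : measurable (F y).
  rewrite FE; apply: fin_bigcap_measurable => // i _.
  by rewrite -[X in measurable X]setTI; apply: mX => //; exact: measurable_cell_set.
have tF : trivIset setT F.
  by apply/trivIsetP => s t _ _; apply: contraNeq => /set0P[x [<- <-]].
have -> : [set w | B (sample_cells w)] = \bigcup_(y in [set` B]) F y.
  by apply/seteqP; split => w /= => [Bw|[t Bt ->]//]; exists (sample_cells w).
split; first exact: fin_bigcup_measurable.
rewrite measure_fintype_bigcup// /pr -sumEFin; apply: eq_bigr => y _.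
transitivity (\prod_(i in [set: 'I_n]%SET) P (X i @^-1` cell_set (y i)))%E.
  rewrite FE; apply: (Xind [set: 'I_n]%SET (fun i => cell_set (y i))) => i.
  exact: measurable_cell_set.
rewrite /prodw -prodEFin; apply: eq_big => [i|i _]; first by rewrite inE.
rewrite /cell_prob (probability_fineK p (measurable_cell_set _)).
by apply: Xp; exact: measurable_cell_set.
Qed.

Lemma finite_halfspace_deviation (L : R) : (0 < n)%N -> 0 <= L ->
  let B := [set w | exists k, 512 * Num.sqrt (n%:R * (d.+1%:R + L)) <
     `|halfspace_deviation (v k) (c k) w|] in
  measurable B /\ (P B <= (expR (- L))%:E)%E.
Proof.
move=> n0 L0 B.
pose bad (y : {ffun 'I_n -> {set K}}) := [exists k,
  512 * Num.sqrt (n%:R * (d.+1%:R + L)) < `|deviation cell_prob cell_in k y|].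
have -> : B = [set w | bad (sample_cells w)].
  have E k w : deviation cell_prob cell_in k (sample_cells w) =
      halfspace_deviation (v k) (c k) w.
    apply: eq_bigr => i _; rewrite ffunE cell_inE sum_cell_prob.
    by congr (_ - fine (p _)); apply/seteqP; split => x /=; rewrite cell_inE.
  apply/seteqP; split => w /=.
    by move=> [k kw]; apply/existsP; exists k; rewrite E.
  by move=> /existsP[k kw]; exists k; rewrite -E.
have [mB ->] := pr_sample_cells bad; split=> //.
rewrite lee_fin; apply: uniform_deviation => //; first exact: cell_prob_weight.
by move=> y; exact: VC_halfspaces.
Qed.

End cells.

(** The bound of [finite_halfspace_deviation] is the same for every finite
    subfamily, hence holds for the increasing union of the exceptional events. *)
Lemma countable_halfspace_deviation (v : nat -> 'cV[R]_d) (c : nat -> R) (L : R) :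
  (0 < n)%N -> 0 <= L ->
  exists E, [/\ measurable E, (P E <= (expR (- L))%:E)%E &
    forall w, ~ E w -> forall k, `|halfspace_deviation (v k) (c k) w| <=
      512 * Num.sqrt (n%:R * (d.+1%:R + L))].
Proof.
move=> n0 L0; set s := 512 * _.
pose B m := [set w | exists k : 'I_m, s < `|halfspace_deviation (v k) (c k) w|].
have H m := @finite_halfspace_deviation _ (fun k : 'I_m => v k) (fun k => c k) L n0 L0.
have mB m : measurable (B m) by exact: (H m).1.
have mUB : measurable (\bigcup_m B m) by exact: bigcup_measurable.
exists (\bigcup_m B m); split=> //.
  have BS : {homo B : n m / (n <= m)%N >-> (n <= m)%O}.
    move=> m m' mm'; apply/subsetPset => w /= [k kw].
    by exists (widen_ord mm' k).
  apply: cvge_le (nondecreasing_cvg_mu mB mUB BS).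
  by apply: nearW => m; exact: (H m).2.
move=> w Ew k; rewrite leNgt; apply/negP => kw; apply: Ew.
by exists k.+1 => //; exists ord_max.
Qed.

End sampling.

(** * Deviations over all closed halfspaces *)

Section closed_halfspaces.
Variables (R : realType) (d : nat).

Lemma cvg_probability_eventually (disp : measure_display) (U : measurableType disp)
    (p : probability U R) (A_ : nat -> set U) (A : set U) :
  (forall j, measurable (A_ j)) -> measurable A ->
  (forall x, \forall j \near \oo, A_ j x <-> A x) ->
  fine (p (A_ j)) @[j --> \oo] --> fine (p A).
Proof.
move=> mA_ mA AA.
have : (\int[p]_x (\1_(A_ j) x)%:E)%E @[j --> \oo] --> (\int[p]_x (\1_A x)%:E)%E.
  apply: (@dominated_cvg _ _ _ p setT _ (fun j x => (\1_(A_ j) x)%:E)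
    (fun x => (\1_A x)%:E) (fun=> 1%E)) => //.
  - by move=> j; exact: measurable_int (integrable_indic p (mA_ j)).
  - move=> x _; apply: cvg_near_cst; apply: filterS (AA x) => j AAj.
    rewrite !indicE; congr (_%:R%:E); congr (nat_of_bool _).
    by apply/idP/idP => /set_mem/AAj/mem_set.
  - exact: (finite_measure_integrable_cst p 1).
  - move=> j x _; rewrite indicE.
    by case: (_ \in _); rewrite /= ?normr1 ?normr0 ?lee_fin// abse0.
rewrite integral_indic// setIT.
under eq_fun do rewrite integral_indic// setIT.
by move=> h; apply: fine_cvg; rewrite probability_fineK.
Qed.

(** Indices that encode no rational data are sent to the empty halfspace. *)
Definition rational_halfspace (k : nat) : 'cV[R]_d * R :=
  if @unpickle ('cV[rat]_d * rat)%type k is Some (v, c)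
  then (map_mx ratr v, ratr c) else (0, 0).

Lemma rational_halfspace_ex (v : 'cV[R]_d) (c e : R) : 0 < e ->
  exists k, [/\ forall i, `|(rational_halfspace k).1 i 0 - v i 0| <= e ^+ 2,
    c - 2 * e < (rational_halfspace k).2 & (rational_halfspace k).2 < c - e].
Proof.
move=> e0.
have /rat_in_itvoo[c' cc'] : c - 2 * e < c - e by lra.
have e2 : 0 < e ^+ 2 by rewrite exprn_gt0.
have H i : exists r : rat, `|ratr r - v i 0| <= e ^+ 2.
  have /rat_in_itvoo[r] : v i 0 - e ^+ 2 < v i 0 + e ^+ 2 by lra.
  rewrite in_itv/= => /andP[r1 r2]; exists r.
  by rewrite ler_distl !ltW.
have [v' vv'] := choice H.
exists (pickle ((\col_i v' i, c') : 'cV[rat]_d * rat)).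
rewrite /rational_halfspace pickleK/=; move: cc'; rewrite in_itv/= => /andP[c1 c2].
by split=> // i; rewrite !mxE.
Qed.

(** Open halfspaces with rational data converge pointwise to any closed
    halfspace, provided that their normals converge faster than their offsets
    (order [e ^+ 2] against order [e]). *)
Lemma rational_halfspace_cvg (v : 'cV[R]_d) (c : R) : exists k : nat -> nat,
  forall x, \forall j \near \oo,
    (rational_halfspace (k j)).2 < dotp (rational_halfspace (k j)).1 x <-> c <= dotp v x.
Proof.
have e0 j : 0 < j.+1%:R^-1 :> R by rewrite invr_gt0.
have [k kP] := choice (fun j => rational_halfspace_ex v c (e0 j)).
exists k => x.
pose S := \sum_i `|x i 0|.
have S0 : 0 <= S by exact: sumr_ge0.
have near_dotp j : `|dotp (rational_halfspace (k j)).1 x - dotp v x| <=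
    j.+1%:R^-1 ^+ 2 * S.
  have [vj _ _] := kP j.
  rewrite !dotp_col -sumrB mulr_sumr (le_trans (ler_norm_sum _ _ _))//.
  apply: ler_sum => i _; rewrite -mulrBl normrM ler_wpM2r//.
pose g := c - dotp v x.
pose N := Num.truncn (S + 3 / `|g|).
exists N => // j /= Nj.
have jN : S + 3 / `|g| < j.+1%:R.
  by rewrite (lt_le_trans (truncnS_gt _))// ler_nat.
have g3 : 0 <= 3 / `|g| by rewrite divr_ge0.
have j0 : (0 : R) < j.+1%:R by [].
have Sj : j.+1%:R^-1 ^+ 2 * S < j.+1%:R^-1.
  rewrite expr2 -mulrA -[X in _ < X]mulr1 ltr_pM2l// mulrC ltr_pdivrMr// mul1r; lra.
have [_ c1 c2] := kP j.
have := near_dotp j; rewrite ler_distl => /andP[d1 d2].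
have [e ee] : exists e, e = j.+1%:R^-1 :> R by exists j.+1%:R^-1.
rewrite -!ee in Sj c1 c2 d1 d2.
split => [kx|cx]; last by lra.
rewrite leNgt; apply/negP => vc.
have g0 : 0 < g by rewrite subr_gt0.
have : 3 < g * j.+1%:R.
  by rewrite mulrC -ltr_pdivrMr//; move: jN; rewrite gtr0_norm//; lra.
have : g < 3 / j.+1%:R by rewrite -ee /g; lra.
by rewrite ltr_pdivlMr// => /lt_trans h /h; rewrite ltxx.
Qed.

Section sampling.
Variables (n : nat) (disp : measure_display)
  (Omega : measurableType disp) (P : probability Omega R)
  (p : probability 'cV[R]_d R) (X : 'I_n -> Omega -> 'cV[R]_d).
Hypothesis Xiid : iid P p X.

(** On the sample the indicators of the approximating halfspaces are eventually
    constant, and their masses converge by dominated convergence; the bound is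
    preserved in the limit. *)
Lemma closed_halfspace_deviation (L : R) : (0 < n)%N -> 0 <= L ->
  exists E, [/\ measurable E, (P E <= (expR (- L))%:E)%E &
    forall w, ~ E w -> forall v c,
      `|\sum_i ((c <= dotp v (X i w))%R%:R - fine (p [set x | c <= dotp v x]))| <=
      512 * Num.sqrt (n%:R * (d.+1%:R + L))].
Proof.
move=> n0 L0.
have [E [mE PE HE]] := countable_halfspace_deviation Xiid
  (fun k => (rational_halfspace k).1) (fun k => (rational_halfspace k).2) n0 L0.
exists E; split=> // w Ew v c.
have [k kP] := rational_halfspace_cvg v c.
set s := 512 * _ in HE *.
have : `|halfspace_deviation p X (rational_halfspace (k j)).1
    (rational_halfspace (k j)).2 w| @[j --> \oo] -->
  `|\sum_i ((c <= dotp v (X i w))%R%:R - fine (p [set x | c <= dotp v x]))|.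
  apply: cvg_norm; apply: (@cvg_big R 'I_n +%R 0 xpredT) => [x|i _].
    by apply: continuousD; [exact: cvg_fst|exact: cvg_snd].
  apply: cvgB.
    apply: cvg_near_cst; apply: filterS (kP (X i w)) => j jP.
    by congr (_%:R); congr nat_of_bool; apply/idP/idP => /jP.
  apply: cvg_probability_eventually => // [j|].
    exact: measurable_open_halfspace.
  exact: measurable_closed_halfspace.
move=> h; rewrite -(cvg_lim _ h)//; apply: limr_le; first exact: cvgP h.
by apply: nearW => j; exact: HE.
Qed.

End sampling.
End closed_halfspaces.

(** * Binomial tail and the geometry of Tukey medians *)

Section binomial_tail.
Variables (R : realType).

(** Chernoff's method, the moment generating function being the binomial
    expansion of [(1 - eps + eps * expR l) ^+ n]. *)
Lemma binomial_tail (n : nat) (eps s : R) (k : nat) :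
  (0 < n)%N -> 0 <= eps <= 1 -> 0 <= s <= 2 * n%:R -> n%:R * eps + s <= k%:R ->
  (binomial_prob n eps [set j | (k <= j)%N] <=
    (expR (- (s ^+ 2 / (8 * n%:R))))%:E)%E.
Proof.
move=> n0 /andP[p0 p1] /andP[s0 s2] sk.
have n0' : (0 : R) < n%:R by rewrite ltr0n.
pose l := s / (4 * n%:R).
have l0 : 0 <= l by rewrite divr_ge0// mulr_ge0.
have l2 : l <= 2^-1 by rewrite ler_pdivrMr ?mulr_gt0//; lra.
rewrite (@binomial_probE R n eps p0 p1).
under eq_bigr do rewrite diracE -EFinM.
rewrite sumEFin lee_fin /bin_prob/=.
apply: (@le_trans _ _ (expR (- (l * k%:R)) * (1 - eps + eps * expR l) ^+ n)).
  rewrite exprDn mulr_sumr; apply: ler_sum => j _.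
  rewrite [leRHS]mulrnAr [leLHS]mulrnAl ler_wMn2r// exprMn.
  have : 0 <= eps ^+ j * (1 - eps) ^+ (n - j).
    by rewrite mulr_ge0 ?exprn_ge0// subr_ge0.
  rewrite -expRM_natl => pj; rewrite /unstable.onem.
  rewrite [leRHS](_ : _ = eps ^+ j * (1 - eps) ^+ (n - j) *
    (expR (- (l * k%:R)) * expR (j%:R * l))); last by ring.
  rewrite ler_wpM2l// -expRD.
  have [/set_mem/= kj|_] := boolP (_ \in _); last exact: expR_ge0.
  rewrite -[leLHS]expR0 ler_expR mulrC -mulNr -mulrDl.
  by rewrite mulr_ge0// addrC subr_ge0 ler_nat.
have : 1 - eps + eps * expR l <= expR (eps * l + 2 * l ^+ 2).
  have hl : expR l <= 1 + l + 2 * l ^+ 2 by apply: expR_le_quad; rewrite ger0_norm.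
  apply: le_trans (expR_ge1Dx _).
  have : eps * expR l <= eps * (1 + l + 2 * l ^+ 2) by rewrite ler_wpM2l.
  have : eps * (2 * l ^+ 2) <= 2 * l ^+ 2 by rewrite ler_piMl// mulr_ge0// sqr_ge0.
  by lra.
move=> /(@lerXn2r _ n); rewrite !nnegrE expR_ge0 addr_ge0 ?subr_ge0// ?mulr_ge0 ?expR_ge0//.
move=> /(_ isT isT)/(ler_wpM2l (expR_ge0 (- (l * k%:R)))) /le_trans; apply.
rewrite -expRM_natl -expRD ler_expR.
have lk : l * (n%:R * eps + s) <= l * k%:R by rewrite ler_wpM2l.
have E1 : l * s = 2 * (s ^+ 2 / (8 * n%:R)) by rewrite /l; field; lra.
have E2 : n%:R * (2 * l ^+ 2) = s ^+ 2 / (8 * n%:R) by rewrite /l; field; lra.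
by rewrite mulrDr E2; lra.
Qed.

End binomial_tail.

Section deterministic.
Variables (R : realType) (d : nat).
Implicit Types (v x mu : 'cV[R]_d) (p : probability 'cV[R]_d R).

Lemma dotpB v x y : dotp v (x - y) = dotp v x - dotp v y.
Proof. by rewrite /dotp mulmxBr !mxE. Qed.

Lemma dotpZ (a : R) v x : dotp (a *: v) x = a * dotp v x.
Proof. by rewrite /dotp linearZ/= -scalemxAl mxE. Qed.

Lemma empirical_halfspace n (y : 'I_n -> 'cV[R]_d) v mu :
  empirical y [set x | 0 <= dotp v (x - mu)] =
  (n%:R^-1 * \sum_i (dotp v mu <= dotp v (y i))%R%:R)%:E.
Proof.
rewrite /empirical EFinM -sumEFin; congr (_ * _)%E; apply: eq_bigr => i _.
rewrite diracE; congr (_%:R%:E); congr nat_of_bool.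
by apply/idP/idP => [/set_mem/=|h]; [|apply/mem_set => /=];
  rewrite dotpB subr_ge0.
Qed.

Section depth.
Variables (N : 'cV[R]_d -> R) (p : probability 'cV[R]_d R) (mu : 'cV[R]_d).

Lemma decay_ge v t : dual_norm N v <= 1 ->
  fine (p [set x | t < dotp v (x - mu)]) <= decay N p mu t.
Proof.
have m u : measurable [set x | t < dotp u (x - mu)].
  have -> : [set x | t < dotp u (x - mu)] = [set x | t + dotp u mu < dotp u x].
    by apply/seteqP; split => x /=; rewrite dotpB ltrBrDr.
  exact: measurable_open_halfspace.
move=> v1; apply: ub_le_sup; last by exists v.
exists 1 => _ [u _ <-]; rewrite -lee_fin probability_fineK//.
exact: probability_le1.
Qed.

(** By homogeneity [decay N p mu 0] bounds the mass of every open
    halfspace with [mu] on its boundary. When the set defining [dual_norm N v]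
    is unbounded, its supremum is [0] by convention and [v] needs no rescaling. *)
Lemma depth_center v : 1 - decay N p mu 0 <= fine (p [set x | 0 <= dotp v (x - mu)]).
Proof.
have pos u : 0 < u -> [set x | 0 < dotp (- v) (x - mu)] =
    [set x | 0 < dotp (u *: (- v)) (x - mu)].
  by move=> u0; apply/seteqP; split => x /=; rewrite dotpZ pmulr_rgt0.
have -> : [set x | 0 <= dotp v (x - mu)] = ~` [set x | 0 < dotp (- v) (x - mu)].
  apply/seteqP; split => x /=; rewrite dotpN oppr_gt0; first by rewrite ltNge => ->.
  by move=> vx; rewrite leNgt; apply/negP.
have m : measurable [set x | 0 < dotp (- v) (x - mu)].
  have -> : [set x | 0 < dotp (- v) (x - mu)] = [set x | dotp (- v) mu < dotp (- v) x].
    by apply/seteqP; split => x /=; rewrite dotpB subr_gt0.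
  exact: measurable_open_halfspace.
rewrite probability_setC// -(probability_fineK p m) -EFinB/= lerD2l lerN2.
have [a a0 a1] : exists2 a, 0 < a & dual_norm N (a *: (- v)) <= 1.
  have [v1|v1] := leP (dual_norm N (- v)) 1; first by exists 1; rewrite ?scale1r.
  have v0 : 0 < dual_norm N (- v) by lra.
  exists (dual_norm N (- v))^-1; first by rewrite invr_gt0.
  have [S0|/nonemptyPn S0] := pselect ([set dotp (- v) x | x in [set x | N x <= 1]] !=set0);
    last by move: v1; rewrite /dual_norm S0 sup0; lra.
  have [Sb|Sb] := pselect (has_ubound [set dotp (- v) x | x in [set x | N x <= 1]]);
    last by move: v1; rewrite /dual_norm sup_out; [lra|case].
  apply: ge_sup; first by case: S0 => _ [x Nx _];
    exists (dotp ((dual_norm N (- v))^-1 *: - v) x), x.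
  move=> _ [x Nx <-]; rewrite dotpZ ler_pdivrMl// mulr1.
  by apply: ub_le_sup => //; exists x.
by rewrite (pos a)//; exact: decay_ge.
Qed.

(** If [muhat] were farther than [t] from the center, the halfspace orthogonal to a
    norming functional of [muhat - mu] through [muhat] would have mass at most
    [decay N p mu t], less than the depth that [muhat] inherits from maximality. *)
Lemma tukey_median_close n (y : 'I_n -> 'cV[R]_d) (eta : R) muhat :
  is_norm N ->
  (forall v c, `|n%:R^-1 * (\sum_i (c <= dotp v (y i))%R%:R) -
     fine (p [set x | c <= dotp v x])| <= eta) ->
  tukey_median (empirical y) muhat ->
  ((N (muhat - mu))%:E <=
    generalized_inverse (decay N p mu) (1 - decay N p mu 0 - 2 * eta))%E.
Proof.
move=> [ND NZ _] dev med; set h := decay N p mu.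
have shift v nu : [set x | 0 <= dotp v (x - nu)] = [set x | dotp v nu <= dotp v x].
  by apply/seteqP; split => x /=; rewrite dotpB subr_ge0.
have depth_mu : ((1 - h 0 - eta)%:E <= tukey_depth mu (empirical y))%E.
  apply/ereal_infP => _ [v _ <-]; rewrite [leRHS]empirical_halfspace lee_fin.
  have := dev v (dotp v mu); rewrite -shift ler_distl => /andP[+ _].
  by have := depth_center v; rewrite -/h; lra.
have depth_hat v : 1 - h 0 - 2 * eta <= fine (p [set x | 0 <= dotp v (x - muhat)]).
  have : ((1 - h 0 - eta)%:E <= empirical y [set x | (0 <= dotp v (x - muhat))%R])%E.
    apply: le_trans depth_mu _; apply: le_trans (med mu) _.
    by apply: ereal_inf_lbound; exists v.
  rewrite [leRHS]empirical_halfspace lee_fin => emp.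
  by have := dev v (dotp v muhat); rewrite -shift ler_distl => /andP[_]; lra.
apply/ereal_infP => _ [t [t0 ht] <-]; rewrite lee_fin leNgt; apply/negP => far.
have Nsub : sublinear N by split=> // a x a0; rewrite NZ ger0_norm.
have [v vz vN] := hahn_banach (muhat - mu) Nsub.
have N0 : N 0 = 0 := sublinear0 Nsub.
have v1 : dual_norm N v <= 1.
  apply: ge_sup; first by exists (dotp v 0), 0 => //=; rewrite N0.
  by move=> _ [x /= Nx <-]; exact: le_trans (vN x) Nx.
have := decay_ge t v1; rewrite -/h; have := depth_hat v.
have : fine (p [set x | 0 <= dotp v (x - muhat)]) <=
    fine (p [set x | t < dotp v (x - mu)]).
  have m1 : measurable [set x | 0 <= dotp v (x - muhat)].
    by rewrite shift; exact: measurable_closed_halfspace.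
  have m2 : measurable [set x | t < dotp v (x - mu)].
    have -> : [set x | t < dotp v (x - mu)] = [set x | t + dotp v mu < dotp v x].
      by apply/seteqP; split => x /=; rewrite dotpB ltrBrDr.
    exact: measurable_open_halfspace.
  rewrite -lee_fin !probability_fineK//; apply: le_measure; rewrite ?inE//.
  move=> x /=; rewrite -vz !dotpB in far *; lra.
by lra.
Qed.

End depth.

Lemma total_variation_close (p q : probability 'cV[R]_d R) (eps : R)
    (A : set 'cV[R]_d) :
  measurable A -> (Defs.total_variation p q <= eps%:E)%E ->
  `|fine (p A) - fine (q A)| <= eps.
Proof.
move=> mA pq.
have H B : measurable B -> fine (p B) - fine (q B) <= eps.
  move=> mB; rewrite -lee_fin EFinB !probability_fineK//.
  by apply: le_trans pq; apply: ereal_sup_ubound; exists B.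
rewrite ler_norml H// andbT.
have := H _ (measurableC mA).
rewrite !probability_setC// -(probability_fineK p mA) -(probability_fineK q mA).
by rewrite -!EFinB/=; lra.
Qed.

Lemma replaced_count n (x y : 'I_n -> 'cV[R]_d) (S : {set 'I_n}) (B : pred 'cV[R]_d) :
  (forall i, i \notin S -> y i = x i) ->
  `|\sum_i (B (y i))%:R - \sum_i (B (x i))%:R| <= #|S|%:R :> R.
Proof.
move=> yx; rewrite -sumrB (le_trans (ler_norm_sum _ _ _))//.
rewrite -sum1_card natr_sum [leRHS]big_mkcond/=; apply: ler_sum => i _.
case: ifPn => [_|/yx->]; last by rewrite subrr normr0.
by case: (B (y i)); case: (B (x i)); rewrite ?subrr ?subr0 ?sub0r ?normrN ?normr0 ?normr1.
Qed.

End deterministic.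

(** * The two corruption models and the main bound *)

Section corruption.
Variables (R : realType) (d n : nat) (disp : measure_display)
  (Omega : measurableType disp) (P : probability Omega R)
  (pstar : probability 'cV[R]_d R).
Implicit Types (X Y : 'I_n -> Omega -> 'cV[R]_d).

Definition empirical_close Y (eta : R) (w : Omega) : Prop :=
  forall v c, `|n%:R^-1 * (\sum_i (c <= dotp v (Y i w))%R%:R) -
    fine (pstar [set x | c <= dotp v x])| <= eta.

Lemma mean_deviation (b : 'I_n -> R) (q s : R) : (0 < n)%N ->
  `|\sum_i (b i - q)| <= s -> `|n%:R^-1 * (\sum_i b i) - q| <= s / n%:R.
Proof.
move=> n0; have n0' : (0 : R) < n%:R by rewrite ltr0n.
rewrite sumrB sumr_const card_ord -[q *+ n]mulr_natl => H.
have -> : n%:R^-1 * (\sum_i b i) - q = (\sum_i b i - n%:R * q) / n%:R.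
  by field; rewrite gt_eqF.
by rewrite normrM [`|_^-1|]ger0_norm ?invr_ge0 ?ler0n// ler_pM2r ?invr_gt0.
Qed.

Lemma oblivious_close Y (eps L : R) : (0 < n)%N -> 0 <= L ->
  oblivious_corruption P pstar eps Y ->
  exists E, [/\ measurable E, (P E <= (expR (- L))%:E)%E & forall w, ~ E w ->
    empirical_close Y (eps + 512 * Num.sqrt (n%:R * (d.+1%:R + L)) / n%:R) w].
Proof.
move=> n0 L0 [p [tv Yiid]].
have [E [mE PE HE]] := closed_halfspace_deviation Yiid n0 L0.
exists E; split=> // w Ew v c.
have := mean_deviation n0 (HE w Ew v c).
have := total_variation_close (measurable_closed_halfspace v c) tv.
by rewrite !ler_distl => /andP[? ?] /andP[? ?]; apply/andP; split; lra.
Qed.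

Lemma replacements_tail (K : Omega -> nat) (eps L : R) : (0 < n)%N -> 0 <= L ->
  0 <= eps <= 1 -> Num.sqrt (8 * n%:R * L) <= 2 * n%:R ->
  measurable_fun setT K -> binomially_dominated n P K eps ->
  exists E, [/\ measurable E, (P E <= (expR (- L))%:E)%E & forall w, ~ E w ->
    (K w)%:R <= n%:R * eps + Num.sqrt (8 * n%:R * L)].
Proof.
move=> n0 L0 eps01 Ln mK domK; set s := Num.sqrt _ in Ln *.
have n0' : (0 : R) < n%:R by rewrite ltr0n.
pose k := (Num.truncn (n%:R * eps + s)).+1.
have ks : n%:R * eps + s < k%:R by exact: truncnS_gt.
exists [set w | (k <= K w)%N]; split.
- by rewrite -[X in measurable X]setTI; apply: (mK measurableT [set j | (k <= j)%N]).
- apply: le_trans (domK k) _.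
  have s02 : 0 <= s <= 2 * n%:R by rewrite sqrtr_ge0.
  have := binomial_tail n0 eps01 s02 (ltW ks).
  rewrite sqr_sqrtr ?mulr_ge0//.
  by have -> : 8 * n%:R * L / (8 * n%:R) = L by field; rewrite gt_eqF.
- move=> w /negP; rewrite -ltnNge ltnS => Kk.
  have : (K w)%:R <= (Num.truncn (n%:R * eps + s))%:R :> R by rewrite ler_nat.
  move=> /le_trans; apply; rewrite truncn_le ?addr_ge0 ?sqrtr_ge0// mulr_ge0//.
  by case/andP: eps01.
Qed.

Lemma adaptive_close Y (eps L : R) : (0 < n)%N -> 0 <= L -> 0 <= eps <= 1 ->
  Num.sqrt (8 * n%:R * L) <= 2 * n%:R ->
  adaptive_corruption P pstar eps Y ->
  exists E, [/\ measurable E, (P E <= (2 * expR (- L))%:E)%E & forall w, ~ E w ->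
    empirical_close Y (eps + (512 * Num.sqrt (n%:R * (d.+1%:R + L)) +
      Num.sqrt (8 * n%:R * L)) / n%:R) w].
Proof.
move=> n0 L0 eps01 Ln [X [K [Xiid mK domK XY]]].
have n0' : (0 : R) < n%:R by rewrite ltr0n.
have [E [mE PE HE]] := closed_halfspace_deviation Xiid n0 L0.
have [F [mF PF HF]] := replacements_tail n0 L0 eps01 Ln mK domK.
exists (E `|` F); split; first exact: measurableU.
  apply: le_trans (measureU2 _ mE mF) _.
  by rewrite mulr_natl mulr2n EFinD leeD.
move=> w /not_orP[Ew Fw] v c.
have [S [SK YX]] := XY w.
have Xdev := mean_deviation n0 (HE w Ew v c).
have := replaced_count (fun x => c <= dotp v x) YX; rewrite SK => /le_trans H.
have {}H := H _ (HF w Fw).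
have {H} : `|n%:R^-1 * (\sum_i (c <= dotp v (Y i w))%R%:R) -
   n%:R^-1 * (\sum_i (c <= dotp v (X i w))%R%:R)| <=
   eps + Num.sqrt (8 * n%:R * L) / n%:R.
  rewrite -mulrBr normrM [`|_^-1|]ger0_norm ?invr_ge0 ?ler0n//.
  rewrite ler_pdivrMl//.
  by have -> : n%:R * (eps + Num.sqrt (8 * n%:R * L) / n%:R) =
    n%:R * eps + Num.sqrt (8 * n%:R * L) by field; rewrite gt_eqF.
rewrite (mulrDl (512 * _)); move: (512 * _ / _) Xdev => dev.
by rewrite !ler_distl => /andP[? ?] /andP[? ?]; apply/andP; split; lra.
Qed.

End corruption.

Theorem theorem3 (R : realType) :
  exists C : R, 0 < C /\
  forall (d : nat) (N : 'cV[R]_d -> R) (pstar : probability 'cV[R]_d R)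
    (mustar : 'cV[R]_d) (n : nat) (delta eps : R)
    (disp : measure_display) (Omega : measurableType disp)
    (P : probability Omega R) (Y : 'I_n -> Omega -> 'cV[R]_d),
  (3 <= d)%N ->
  is_norm N ->
  halfspace_symmetric pstar mustar ->
  (1 <= n)%N ->
  0 < delta < 1 ->
  0 <= eps < 1 ->
  oblivious_corruption P pstar eps Y \/ adaptive_corruption P pstar eps Y ->
  let h := decay N pstar mustar in
  let epst := eps + C * Num.sqrt ((d%:R + 1 + ln (1 / delta)) / n%:R) in
  2 * epst < 1 - h 0 ->
  with_probability_ge P (1 - delta)
    [set w | forall muhat : 'cV[R]_d,
       tukey_median (empirical (fun i => Y i w)) muhat ->
       ((N (muhat - mustar))%:E <=
          generalized_inverse h (1 - h 0 - 2 * epst)%R)%E].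
Proof.
(* [1027 = 2 * 512 + 3], from [dev_le] and [tail_le] below. *)
have [C C0 CE] : exists2 C : R, 0 < C & C = 1027 by exists 1027; rewrite ?ltr0n.
exists C; split=> // d N pstar mustar n delta eps disp Omega P Y _ Nnorm _ n0.
move=> /andP[delta0 delta1] /andP[eps0 eps1] corr h epst small.
have n0' : (0 : R) < n%:R by rewrite ltr0n.
set L0 := ln (1 / delta) in epst small *.
have L0_ge0 : 0 <= L0 by rewrite ln_ge0// ler_pdivlMr// mul1r ltW.
(* Two exceptional events of probability at most [expR (- L)] occur in the
   adaptive model; the additional [1] in [L] pays for both. *)
pose L := L0 + 1.
have L_ge0 : 0 <= L by rewrite addr_ge0.
have expL : 2 * expR (- L) <= delta.
  have e2 : (2 : R) <= expR 1 by apply: le_trans (expR_ge1Dx 1).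
  have -> : expR (- L) = delta / expR 1.
    by rewrite opprD expRD expRN lnK ?posrE ?divr_gt0// div1r invrK expRN.
  by rewrite mulrA ler_pdivrMr ?expR_gt0// mulrC ler_pM2l.
set r := Num.sqrt _ in epst small *.
have r0 : 0 <= r by exact: sqrtr_ge0.
have Cr : C * r = 1027 * r by rewrite CE.
have h0 : 0 <= h 0.
  have := depth_center N pstar mustar 0; rewrite -/h.
  have : fine (pstar [set x | 0 <= dotp 0 (x - mustar)]) <= 1.
    have -> : [set x | 0 <= dotp 0 (x - mustar)] = setT.
      by apply/seteqP; split => // x _ /=; rewrite /dotp trmx0 mul0mx mxE.
    by rewrite probability_setT.
  lra.
pose u := Num.sqrt (n%:R * (d.+1%:R + L0)).
have u0 : 0 <= u by exact: sqrtr_ge0.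
have rE : r = u / n%:R.
  suff -> : u = r * n%:R by rewrite mulfK// gt_eqF.
  rewrite -[X in r * X]ger0_norm ?ler0n// -sqrtr_sqr /r natr1.
  rewrite -sqrtrM; last by rewrite divr_ge0 ?addr_ge0.
  by congr Num.sqrt; field; rewrite gt_eqF.
have d1 : (1 : R) <= d.+1%:R by rewrite ler1n.
have dev_le : Num.sqrt (n%:R * (d.+1%:R + L)) <= 2 * u.
  rewrite -[2 * u]ger0_norm ?mulr_ge0// -sqrtr_sqr ler_wsqrtr// exprMn.
  rewrite sqr_sqrtr ?mulr_ge0 ?addr_ge0// mulrCA ler_wpM2l ?ler0n// /L; lra.
have tail_le : Num.sqrt (8 * n%:R * L) <= 3 * u.
  rewrite -[3 * u]ger0_norm ?mulr_ge0// -sqrtr_sqr ler_wsqrtr// exprMn.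
  have b0 : 0 <= n%:R * (d.+1%:R + L0) by rewrite mulr_ge0 ?addr_ge0.
  have : n%:R * L <= n%:R * (d.+1%:R + L0) by rewrite ler_wpM2l ?ler0n// /L; lra.
  rewrite sqr_sqrtr// -mulrA.
  by move: (n%:R * L) (n%:R * _) b0 => a b; lra.
(* The hypothesis on [epst] bounds the deviation term by one half, which brings
   the binomial tail within the range of [binomial_tail]. *)
have un : u <= n%:R / 3.
  have : u / n%:R <= 3^-1 by rewrite -rE; move: small; rewrite /epst; lra.
  by rewrite ler_pdivrMr// mulrC.
have [E [mE PE HE]] : exists E, [/\ measurable E, (P E <= delta%:E)%E &
    forall w, ~ E w -> empirical_close pstar Y epst w].
  have widen (eta : R) (w : Omega) : eta <= epst ->
      empirical_close pstar Y eta w -> empirical_close pstar Y epst w.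
    by move=> le_eta H v c; exact: le_trans (H v c) le_eta.
  have scale (t s : R) : s <= t * u -> s / n%:R <= t * r.
    by move=> st; rewrite rE mulrA ler_pM2r ?invr_gt0.
  case: corr => [/(oblivious_close n0 L_ge0)|corr].
    move=> [E [mE PE HE]]; exists E; split=> //.
      apply: le_trans PE _; rewrite lee_fin; have := expR_ge0 (- L); lra.
    move=> w /HE; apply: widen; rewrite lerD2l Cr scale//; lra.
  have tail2 : Num.sqrt (8 * n%:R * L) <= 2 * n%:R by lra.
  have eps01 : 0 <= eps <= 1 by rewrite eps0 ltW.
  have [E [mE PE HE]] := adaptive_close n0 L_ge0 eps01 tail2 corr.
  exists E; split=> //; first by apply: le_trans PE _; rewrite lee_fin.
  by move=> w /HE; apply: widen; rewrite lerD2l Cr scale//; lra.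
exists (~` E); split; first exact: measurableC.
  by move=> w /HE close muhat; exact: tukey_median_close.
by rewrite probability_setC// EFinB leeB.
Qed.
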